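(* Let $q(t)$ be a solution, not identically zero, of the Painlevé II equation $q''=2q^3+tq$, let $u=(q')^2-tq^2-q^4$ (so $u'=-q^2$), and consider the linear system of ODEs for $(\mu_+,\mu_-,\nu)$: $$3q^2\mu_+'=(q^2)'\mu_+-q^2\nu,\qquad 3q^2\mu_-'=-(q^2)'\mu_-+q^2\nu,\qquad 3q^2\nu'=2q^4\mu_--2u\mu_+.$$ Let $t_0\in\mathbb C$ be any zero of $q$. Then near $t_0$ there are three types of series solutions of this system: 1) solutions with exponents $m_+=m_-=4/3$, $m_\nu=1/3$ and one free constant; 2) solutions with exponents $m_+=m_-=1/3$, $m_\nu=-2/3$ and two free constants; 3) solutions with exponents $m_+=1/3$, $m_-=m_\nu=-2/3$ and three free constants. The third type is thus generic (it contains as many free constants as the order of the system).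
   Context: Put $z=t-t_0$ and fix a branch of $z^{1/3}$ near $z=0$. A series solution ''with exponents $m_+,m_-,m_\nu$'' is a local solution of the form $$\mu_+=z^{m_+}\sum_{n\ge0}K_nz^n,\qquad \mu_-=z^{m_-}\sum_{n\ge0}M_nz^n,\qquad \nu=z^{m_\nu}\sum_{n\ge0}S_nz^n$$ (no logarithmic terms). Saying that a type has ''$N$ free constants'' means that the solutions of this form (with leading coefficients allowed to vanish) make up an $N$-dimensional complex vector space: $N$ of the coefficients can be chosen arbitrarily and all other coefficients are then determined recursively; for generic choices of the free constants the leading coefficients $K_0,M_0,S_0$ are all nonzero, so that the exponents are the actual leading exponents. All solutions of $q''=2q^3+tq$ are meromorphic in $\mathbb C$, and all zeros of a nontrivial solution are simple. *)

(* Defs.v *)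
(* Stdlib reals with Coquelicot's complex numbers. *)
From Stdlib Require Export Reals List ZArith.
From Coquelicot Require Export Coquelicot.
Open Scope C_scope.

Definition domain (U : C -> Prop) : Prop :=
  open (T := C_UniformSpace) U /\
  forall A B : C -> Prop,
    open (T := C_UniformSpace) A -> open (T := C_UniformSpace) B ->
    (forall z, U z -> A z \/ B z) ->
    (exists z, U z /\ A z) -> (exists z, U z /\ B z) ->
    exists z, U z /\ A z /\ B z.

Definition C_differentiable (f : C -> C) (t : C) : Prop :=
  ex_derive (K := C_AbsRing) (V := C_NormedModule) f t.

(* [C_derive f t] is meaningful only where [f] is complex differentiable (it is
   computed along the real direction), hence the explicit differentiability
   requirements here and in [linear_system]. *)
Definition painleve2_solution (U : C -> Prop) (q : C -> C) : Prop :=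
  forall t, U t ->
    C_differentiable q t /\
    C_differentiable (C_derive q) t /\
    C_derive (C_derive q) t = 2 * q t ^ 3 + t * q t.

Definition u_of (q : C -> C) (t : C) : C :=
  C_derive q t ^ 2 - t * q t ^ 2 - q t ^ 4.

(* Indices of the three unknown functions mu_+, mu_-, nu. *)
Inductive unknown := mu_plus | mu_minus | nu.

Definition linear_system (q : C -> C) (f : unknown -> C -> C) (t : C) : Prop :=
  (forall x, C_differentiable (f x) t) /\
  3 * q t ^ 2 * C_derive (f mu_plus) t
    = C_derive (fun s => q s ^ 2) t * f mu_plus t - q t ^ 2 * f nu t /\
  3 * q t ^ 2 * C_derive (f mu_minus) t
    = - C_derive (fun s => q s ^ 2) t * f mu_minus t + q t ^ 2 * f nu t /\
  3 * q t ^ 2 * C_derive (f nu) t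
    = 2 * q t ^ 4 * f mu_minus t - 2 * u_of q t * f mu_plus t.

(* [r] is a branch of z^(1/3) on the domain [V], which excludes 0 but
   accumulates at 0 (for instance a slit disc). *)
Definition cbrt_branch (V : C -> Prop) (r : C -> C) : Prop :=
  domain V /\ ~ V 0 /\
  (forall P : C -> Prop, locally (T := C_UniformSpace) (RtoC 0) P ->
     exists z, V z /\ P z) /\
  forall z, V z ->
    continuous (T := C_UniformSpace) (U := C_UniformSpace) r z /\ r z ^ 3 = z.

(* z^(k/3), computed with the branch [r] of z^(1/3). *)
Definition third_pow (r : C -> C) (k : Z) (z : C) : C :=
  match k with
  | Z0 => 1
  | Zpos p => r z ^ Pos.to_nat p
  | Zneg p => / (r z ^ Pos.to_nat p)
  end.

(* The exponents m_+ = kp/3, m_- = km/3, m_nu = kn/3. *)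
Definition thirds (kp km kn : Z) (x : unknown) : Z :=
  match x with mu_plus => kp | mu_minus => km | nu => kn end.

(* The local solution [f], near [t0] on the domain of the branch, is the series
   solution with exponents [k x / 3] and coefficients [a x n]: K_n, M_n, S_n
   are [a mu_plus n], [a mu_minus n], [a nu n]. *)
Definition series_solution (V : C -> Prop) (r q : C -> C) (t0 : C)
    (k : unknown -> Z) (f : unknown -> C -> C) (a : unknown -> nat -> C)
    : Prop :=
  within V (locally (T := C_UniformSpace) (RtoC 0)) (fun z =>
    linear_system q f (t0 + z) /\
    forall x, exists s : C,
      is_pseries (K := C_AbsRing) (V := C_NormedModule) (a x) z s /\
      f x (t0 + z) = third_pow r (k x) z * s).

(* Equality of germs at [t0] of triples of functions on [t0 + V]. *)
Definition germ_eq (V : C -> Prop) (t0 : C) (f g : unknown -> C -> C) : Prop :=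
  within V (locally (T := C_UniformSpace) (RtoC 0)) (fun z =>
    forall x, f x (t0 + z) = g x (t0 + z)).

(* The indices of families of [N] objects are 1, ..., N. *)
Definition lin_comb (N : nat) (c v : nat -> C) : C :=
  sum_n_m (G := C_AbelianMonoid) (fun i => c i * v i) 1 N.

(* Modulo equality of germs, the triples satisfying [E] are exactly the linear
   combinations of [N] linearly independent triples. *)
Definition germ_space_of_dimension (V : C -> Prop) (t0 : C)
    (E : (unknown -> C -> C) -> Prop) (N : nat) : Prop :=
  exists b : nat -> unknown -> C -> C,
    (forall f, E f <-> exists c,
       germ_eq V t0 f (fun x t => lin_comb N c (fun i => b i x t))) /\
    (forall c, germ_eq V t0 (fun x t => lin_comb N c (fun i => b i x t))
                 (fun _ _ => 0) ->
       forall i, (1 <= i <= N)%nat -> c i = 0).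

(* [P] holds off a finite union of proper linear hyperplanes of C^N. *)
Definition generically (N : nat) (P : (nat -> C) -> Prop) : Prop :=
  exists hyps : list (nat -> C),
    (forall h, In h hyps -> exists i, (1 <= i <= N)%nat /\ h i <> 0) /\
    (forall c, (forall h, In h hyps -> lin_comb N h c <> 0) -> P c).

(* A position [(x, n)] designates the coefficient [a x n].  The free constants
   are the coefficients at the positions p 1, ..., p N.  The second clause on
   [p] is the recursion: the coefficients of index [n] are determined by those
   of lower index and the free constants of index [n]. *)
Definition series_type (V : C -> Prop) (r q : C -> C) (t0 : C)
    (k : unknown -> Z) (N : nat) : Prop :=
  let sol := series_solution V r q t0 k in
  germ_space_of_dimension V t0 (fun f => exists a, sol f a) N /\
  exists p : nat -> unknown * nat,
    (forall c : nat -> C, exists f a, sol f a /\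
       forall i, (1 <= i <= N)%nat -> a (fst (p i)) (snd (p i)) = c i) /\
    (forall f a f' a' n, sol f a -> sol f' a' ->
       (forall x j, (j < n)%nat -> a x j = a' x j) ->
       (forall i, (1 <= i <= N)%nat -> snd (p i) = n ->
          a (fst (p i)) n = a' (fst (p i)) n) ->
       forall x, a x n = a' x n) /\
    generically N (fun c => forall f a, sol f a ->
       (forall i, (1 <= i <= N)%nat -> a (fst (p i)) (snd (p i)) = c i) ->
       forall x, a x 0%nat <> 0).

(* Main.v *)
Require Import Defs.
From Stdlib Require Import Lra Lia FunctionalExtensionality.

(** A zero [t0] of [q] is simple: otherwise [q] and [q'] vanish together there,
    and local uniqueness for Painlevé II makes the set of common zeros open and
    closed in [U].  So [q (t0 + z) = z g(z)] with [g] analytic and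
    [g(0) <> 0] (the convergent formal solution of Painlevé II coincides with [q] by
    uniqueness), and [g' = z K g] because [q''(t0) = 0].

    With [mu_+ = z^(1/3) A], [mu_- = z^(-2/3) B], [nu = z^(-2/3) C], the linear
    system is Fuchsian at [z = 0] with indices 0, 0, 1.  It forces
    [A(0) = C(0)], and in terms of [D = (A - C) / z] it becomes regular:
<<
      A' =  (2/3) z K A + D / 3
      B' = -(2/3) z K B + (A - z D) / 3
      D' =  (2/3) (3 K + z^2 K^2 - (t0 + z) - z^2 g^2) A - (2/3) z g^2 B
>>
    So there is no logarithm at the resonance, and the solutions of type 3 are
    parametrised by [A(0)], [B(0)] and [D(0) = 3 A'(0)].  Types 2 and 1 are the
    subspaces [B(0) = 0] and [A(0) = B(0) = 0]. *)

(** * Complex derivatives *)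

(** The resonance is decided by one cancellation. Before [g' = z K g] is used, the equations for [A]
    and [C] give [z D' = (1/3 + 2/3 - 1) D + 2 (g'/g) A + O(z)]. The terms in [D] drop out because
    the index is 1, and a logarithm could only come from [2 (g'/g)(0) A(0)]. This vanishes because
    [q''(t0) = 0]; division by [z] then leaves [2 K A], the origin of the [3 K] in the third
    equation.

    The exponents of types 1 and 2 are the true leading ones because [B'(0) = A(0) / 3], and because
    [A(0) = B(0) = 0] makes the leading coefficients of [A], [B], [C] equal to [A'(0)],
    [- A'(0) / 3], [- 2 A'(0)].

    Solutions live only on [V], where the branch exists, and not all around [t0]. Once the powers of
    the branch are divided out, the equations relate convergent power series, and an identity
    theorem for sets accumulating at 0 turns them into recursions. Dimension, free constants and
    genericity are then linear algebra on coefficient sequences. *)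

Notation near z := (locally (T := C_UniformSpace) (z%C : C)).
Notation has_derivative f z l :=
  (is_derive (K := C_AbsRing) (V := C_NormedModule) f (z%C : C) (l%C : C)).

(** Balls of [C_UniformSpace] are squares, products of two real balls, hence the factor [sqrt 2] in
    one direction. *)
Lemma near_Cmod (z : C) (P : C -> Prop) :
  near z P <-> exists d : R, (0 < d)%R /\ forall y, (Cmod (y - z) < d)%R -> P y.
Proof.
split.
- intros [eps H]. exists eps. split; [apply cond_pos|].
  intros y Hy. apply H. apply (C_NormedModule_mixin_compat1 z y eps). exact Hy.
- intros [d [Hd H]].
  assert (Hs : (0 < sqrt 2)%R) by (apply sqrt_lt_R0; lra).
  assert (He : (0 < d / sqrt 2)%R) by (apply Rdiv_lt_0_compat; lra).
  exists (mkposreal _ He). intros y Hy. apply H.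
  replace d with (sqrt 2 * mkposreal _ He)%R by (simpl; field; lra).
  apply (C_NormedModule_mixin_compat2 z y). exact Hy.
Qed.

Lemma near_AbsRing (z : C) (P : C -> Prop) :
  near z P <-> locally (T := AbsRing_UniformSpace C_AbsRing) z P.
Proof. apply locally_C. Qed.

Lemma near_mp (z : C) (P Q : C -> Prop) :
  near z P -> near z (fun y => P y -> Q y) -> near z Q.
Proof.
intros HP HQ. apply (filter_imp (fun y => P y /\ (P y -> Q y))).
- tauto.
- apply filter_and; assumption.
Qed.

Lemma near_ball (z : C) (d : R) : (0 < d)%R -> near z (fun y => (Cmod (y - z) < d)%R).
Proof. intros Hd. apply near_Cmod. exists d. auto. Qed.

Lemma near_small (d : R) : (0 < d)%R -> near 0 (fun y => (Cmod y < d)%R).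
Proof.
intros Hd. apply near_Cmod. exists d. split; auto. intros y.
replace (y - 0) with y by ring. auto.
Qed.

Lemma near_near (z : C) (P : C -> Prop) : near z P -> near z (fun y => near y P).
Proof. apply locally_locally. Qed.

Lemma near_shift (t : C) (P : C -> Prop) :
  near t P <-> near 0 (fun z => P (t + z)).
Proof.
rewrite !near_Cmod. split; intros [d [Hd H]]; exists d; split; auto; intros y Hy.
- apply H. replace (t + y - t) with (y - 0) by ring. exact Hy.
- replace y with (t + (y - t)) by ring. apply H.
  replace (y - t - 0) with (y - t) by ring. exact Hy.
Qed.

Lemma near_shift_at (t z : C) (P : C -> Prop) :
  near (t + z) P <-> near z (fun y => P (t + y)).
Proof.
rewrite !near_Cmod. split; intros [d [Hd H]]; exists d; split; auto; intros y Hy.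
- apply H. replace (t + y - (t + z)) with (y - z) by ring. exact Hy.
- replace y with (t + (y - t)) by ring. apply H.
  replace (y - t - z) with (y - (t + z)) by ring. exact Hy.
Qed.

(** [is_derive_mult] sees the ring as a module over itself. Both structures have the same norm and
    operations, so only the record [is_linear] has to be rebuilt. *)
Lemma derivative_AbsRing (f : C -> C) (z l : C) :
  has_derivative f z l <->
  is_derive (K := C_AbsRing) (V := AbsRing_NormedModule C_AbsRing) f z l.
Proof.
split; intros [[Ha Hb Hc] H];
  (split; [constructor; [exact Ha|exact Hb|exact Hc] | exact H]).
Qed.

Lemma derivative_Cmod (f : C -> C) (z l : C) :
  has_derivative f z l <->
  forall eps : R, (0 < eps)%R ->
    near z (fun y => (Cmod (f y - f z - (y - z) * l) <= eps * Cmod (y - z))%R).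
Proof.
split.
- intros [_ H] eps Heps.
  specialize (H z (fun P HP => HP) (mkposreal eps Heps)).
  apply near_AbsRing. exact H.
- intros H. split; [apply is_linear_scal_l|].
  intros x Hx.
  apply (@is_filter_lim_locally_unique C_AbsRing (AbsRing_NormedModule C_AbsRing)) in Hx.
  rewrite <- Hx.
  intros eps. apply near_AbsRing. apply (H eps). apply cond_pos.
Qed.

Lemma C_derive_spec (f : C -> C) (z : C) :
  C_differentiable f z -> has_derivative f z (C_derive f z).
Proof. apply (C_derive_correct f z 0). Qed.

Lemma derivative_ext (f g : C -> C) (z l : C) :
  near z (fun y => f y = g y) -> has_derivative f z l -> has_derivative g z l.
Proof. intros H. apply is_derive_ext_loc. apply near_AbsRing. exact H. Qed.

Lemma derivative_eq (f : C -> C) (z l l' : C) :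
  has_derivative f z l -> l = l' -> has_derivative f z l'.
Proof. intros H <-. exact H. Qed.

Lemma derivative_const (c z : C) : has_derivative (fun _ => c) z 0.
Proof. apply (is_derive_const (K := C_AbsRing) (V := C_NormedModule)). Qed.

Lemma derivative_mult (f g : C -> C) (z l m : C) :
  has_derivative f z l -> has_derivative g z m ->
  has_derivative (fun y => f y * g y) z (l * g z + f z * m).
Proof.
intros Hf Hg. apply derivative_AbsRing.
apply (is_derive_mult (K := C_AbsRing)); try (apply derivative_AbsRing; assumption).
apply Cmult_comm.
Qed.

Lemma derivative_minus (f g : C -> C) (z l m : C) :
  has_derivative f z l -> has_derivative g z m ->
  has_derivative (fun y => f y - g y) z (l - m).
Proof. apply (is_derive_minus (K := C_AbsRing) (V := C_NormedModule)). Qed.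

Lemma derivative_shift (f : C -> C) (t z l : C) :
  has_derivative f (t + z) l <-> has_derivative (fun y => f (t + y)) z l.
Proof.
rewrite !derivative_Cmod. split; intros H eps Heps; specialize (H eps Heps).
- apply near_shift_at in H. revert H. apply filter_imp. intros y.
  replace (t + y - (t + z)) with (y - z) by ring. auto.
- apply near_shift_at. revert H. apply filter_imp. intros y.
  replace (t + y - (t + z)) with (y - z) by ring. auto.
Qed.

Lemma derivative_continuous (f : C -> C) (z l : C) :
  has_derivative f z l ->
  forall eps : R, (0 < eps)%R -> near z (fun y => (Cmod (f y - f z) < eps)%R).
Proof.
intros H eps Heps.
apply derivative_Cmod with (eps := 1%R) in H; [|lra].
assert (Hl : (0 < 1 + Cmod l)%R) by (pose proof (Cmod_ge_0 l); lra).
refine (near_mp _ _ _ H _).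
refine (near_mp _ _ _ (near_ball z (eps / (1 + Cmod l)) _) _).
{ apply Rdiv_lt_0_compat; lra. }
apply filter_forall. intros y Hy Hf.
apply Rmult_lt_compat_r with (r := (1 + Cmod l)%R) in Hy; auto.
replace (eps / (1 + Cmod l) * (1 + Cmod l))%R with eps in Hy by (field; lra).
replace (f y - f z) with ((f y - f z - (y - z) * l) + (y - z) * l) by ring.
eapply Rle_lt_trans; [apply Cmod_triangle|]. rewrite Cmod_mult. lra.
Qed.

Lemma derivative_nonzero_near (f : C -> C) (z l : C) :
  has_derivative f z l -> f z <> 0 -> near z (fun y => f y <> 0).
Proof.
intros H Hz. assert (Hm := proj1 (Cmod_gt_0 _) Hz).
generalize (derivative_continuous f z l H (Cmod (f z)) Hm). apply filter_imp.
intros y Hy E. rewrite E in Hy.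
replace (0 - f z) with (- f z) in Hy by ring. rewrite Cmod_opp in Hy. lra.
Qed.

(** The factor 2 comes from treating real and imaginary parts separately. *)
Lemma mean_value_bound (f f' : C -> C) (z : C) (B : R) :
  (forall y, (Cmod y <= Cmod z)%R ->
     has_derivative f y (f' y) /\ (Cmod (f' y) <= B)%R) ->
  (Cmod (f z - f 0) <= 2 * B * Cmod z)%R.
Proof.
intros H.
assert (Hz := Cmod_ge_0 z).
assert (Hin : forall s : R, (Rabs s <= 1)%R -> (Cmod (s * z) <= Cmod z)%R).
{ intros s Hs. rewrite Cmod_mult, Cmod_R.
  apply Rle_trans with (1 * Cmod z)%R; [apply Rmult_le_compat_r|]; lra. }
(* [pr] stands for [Re] or [Im], so that the real inequality [bounded_variation] applies to
   [s |-> pr (f (s z))] between 0 and 1; it asks for the derivative at all [|s| <= 1]. *)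
assert (HP : forall pr : C -> R,
   (forall a b : C, pr (a - b)%C = (pr a - pr b)%R) ->
   (forall (s : R) (b : C), pr (s * b)%C = (s * pr b)%R) ->
   (forall a : C, Rabs (pr a) <= Cmod a)%R ->
   (Rabs (pr (f z - f 0)%C) <= B * Cmod z)%R).
{ intros pr Pm Ps Pa. rewrite Pm.
  assert (Hb := bounded_variation (fun s : R => pr (f (s * z)))
    (fun s : R => pr (z * f' (s * z))) (B * Cmod z) 0 1).
  cbv beta in Hb. rewrite Cmult_1_l, Cmult_0_l, Rminus_0_r, Rabs_R1, Rmult_1_r in Hb.
  apply Hb. clear Hb. intros s Hs. rewrite Rminus_0_r in Hs.
  destruct (H (s * z) (Hin s Hs)) as [Hd HB]. split.
  2:{ eapply Rle_trans; [apply Pa|]. rewrite Cmod_mult, Rmult_comm.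
      apply Rmult_le_compat_r; lra. }
  split; [apply is_linear_scal_l|].
  intros x Hx.
  apply (@is_filter_lim_locally_unique R_AbsRing (AbsRing_NormedModule R_AbsRing)) in Hx.
  rewrite <- Hx.
  intros [eps Heps].
  assert (He : (0 < eps / (1 + Cmod z))%R) by (apply Rdiv_lt_0_compat; lra).
  apply (proj1 (derivative_Cmod _ _ _)) with (eps := (eps / (1 + Cmod z))%R) in Hd;
    [|exact He].
  apply near_Cmod in Hd. destruct Hd as [d [Hd0 Hd]].
  assert (Hd' : (0 < d / (1 + Cmod z))%R) by (apply Rdiv_lt_0_compat; lra).
  exists (mkposreal _ Hd'). intros s' Hs'. change (Rabs (s' - s) < d / (1 + Cmod z))%R in Hs'.
  change (Rabs ((pr (f (s' * z)%C) - pr (f (s * z)%C)) - (s' - s) * pr (z * f' (s * z))%C)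
    <= eps * Rabs (s' - s))%R.
  rewrite <- Ps, <- !Pm.
  eapply Rle_trans; [apply Pa|].
  assert (E : Cmod (s' * z - s * z) = (Rabs (s' - s) * Cmod z)%R).
  { replace (s' * z - s * z) with ((s' - s)%R * z) by (rewrite RtoC_minus; ring).
    rewrite Cmod_mult, Cmod_R. reflexivity. }
  assert (Hs2 : (Rabs (s' - s) * Cmod z < d)%R).
  { apply Rle_lt_trans with (Rabs (s' - s) * (1 + Cmod z))%R.
    - apply Rmult_le_compat_l; [apply Rabs_pos|lra].
    - apply Rmult_lt_compat_r with (r := (1 + Cmod z)%R) in Hs'; [|lra].
      replace (d / (1 + Cmod z) * (1 + Cmod z))%R with d in Hs' by (field; lra).
      exact Hs'. }
  specialize (Hd (s' * z)). rewrite E in Hd. specialize (Hd Hs2).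
  replace (f (s' * z) - f (s * z) - (s' - s)%R * (z * f' (s * z)))
    with (f (s' * z) - f (s * z) - (s' * z - s * z) * f' (s * z))
    by (rewrite RtoC_minus; ring).
  eapply Rle_trans; [exact Hd|].
  replace (eps / (1 + Cmod z) * (Rabs (s' - s) * Cmod z))%R
    with ((eps * Rabs (s' - s)) * (Cmod z / (1 + Cmod z)))%R by (field; lra).
  rewrite <- (Rmult_1_r (eps * Rabs (s' - s))) at 2.
  apply Rmult_le_compat_l.
  - apply Rmult_le_pos; [lra|apply Rabs_pos].
  - apply Rmult_le_reg_r with (1 + Cmod z)%R; [lra|].
    replace (Cmod z / (1 + Cmod z) * (1 + Cmod z))%R with (Cmod z) by (field; lra). lra. }
assert (Hre := HP Re ltac:(intros; unfold Cminus; rewrite re_plus, re_opp; ring)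
  re_scal_l re_le_Cmod).
assert (Him := HP Im ltac:(intros; unfold Cminus; rewrite im_plus, im_opp; ring)
  im_scal_l (fun a => Rle_trans _ _ _ (Rmax_r _ _) (Rmax_Cmod a))).
set (w := f z - f 0) in *.
replace w with (Re w + Ci * Im w).
2:{ apply injective_projections; simpl; unfold Re, Im; ring. }
eapply Rle_trans; [apply Cmod_triangle|].
rewrite Cmod_mult, !Cmod_R, Cmod_Ci. lra.
Qed.

(** * Complex power series *)

Notation has_sum u l := (is_series (K := C_AbsRing) (V := C_NormedModule) u (l%C : C)).

Lemma sum_n_parts (u : nat -> C) n :
  Re (sum_n (G := C_AbelianMonoid) u n) = sum_n (fun k => Re (u k)) n /\
  Im (sum_n (G := C_AbelianMonoid) u n) = sum_n (fun k => Im (u k)) n.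
Proof.
induction n; [rewrite !sum_O; auto|].
destruct IHn as [IH1 IH2]. rewrite !sum_Sn, <- IH1, <- IH2. split; reflexivity.
Qed.

Lemma has_sum_parts (u : nat -> C) (l : C) :
  has_sum u l <->
  is_series (fun n => Re (u n)) (Re l) /\ is_series (fun n => Im (u n)) (Im l).
Proof.
assert (HR := fun n => proj1 (sum_n_parts u n)).
assert (HI := fun n => proj2 (sum_n_parts u n)).
unfold is_series. split.
- intros H. split.
  + apply filterlim_locally. intros eps.
    generalize (proj1 (filterlim_locally _ _) H eps). apply filter_imp.
    intros n [Hb _]. rewrite <- HR. exact Hb.
  + apply filterlim_locally. intros eps.
    generalize (proj1 (filterlim_locally _ _) H eps). apply filter_imp.
    intros n [_ Hb]. rewrite <- HI. exact Hb.
- intros [H1 H2]. apply filterlim_locally. intros eps.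
  generalize (filter_and _ _ (proj1 (filterlim_locally _ _) H1 eps)
                             (proj1 (filterlim_locally _ _) H2 eps)).
  apply filter_imp. intros n [Hb1 Hb2]. split.
  + rewrite <- HR in Hb1. exact Hb1.
  + rewrite <- HI in Hb2. exact Hb2.
Qed.

Lemma has_sum_ext (u v : nat -> C) (l : C) :
  (forall n, u n = v n) -> has_sum u l -> has_sum v l.
Proof. apply is_series_ext. Qed.

Lemma has_sum_exists (u : nat -> C) (b : nat -> R) :
  (forall n, (Cmod (u n) <= b n)%R) -> ex_series b -> exists l, has_sum u l.
Proof.
intros H Hb.
exact (ex_series_le (K := C_AbsRing) (V := C_CompleteNormedModule) u b H Hb).
Qed.

Lemma has_sum_bound (u : nat -> C) (l : C) (b : nat -> R) (B : R) :
  (forall n, (Cmod (u n) <= b n)%R) -> has_sum u l -> is_series b B -> (Cmod l <= B)%R.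
Proof.
intros H Hu Hb.
assert (Hl : is_lim_seq (fun n => Cmod (sum_n (G := C_AbelianMonoid) u n)) (Cmod l)).
{ unfold is_lim_seq. simpl.
  eapply filterlim_comp; [exact Hu|].
  exact (filterlim_norm (K := C_AbsRing) (V := C_NormedModule) l). }
assert (Hb' : is_lim_seq (sum_n b) B) by exact Hb.
refine (is_lim_seq_le _ _ _ _ _ Hl Hb').
induction n.
- rewrite !sum_O. apply H.
- rewrite !sum_Sn. eapply Rle_trans; [apply Cmod_triangle|].
  apply Rplus_le_compat; [exact IHn|apply H].
Qed.

Lemma has_sum_plus (u v : nat -> C) (l m : C) :
  has_sum u l -> has_sum v m -> has_sum (fun n => u n + v n) (l + m).
Proof. apply (is_series_plus (K := C_AbsRing) (V := C_NormedModule)). Qed.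

Lemma has_sum_scal (c : C) (u : nat -> C) (l : C) :
  has_sum u l -> has_sum (fun n => c * u n) (c * l).
Proof. apply (is_series_scal (K := C_AbsRing) (V := C_NormedModule)). Qed.

Lemma has_sum_cons (u : nat -> C) (l : C) :
  has_sum (fun n => u (S n)) l <-> has_sum u (u 0%nat + l).
Proof.
split; intros H.
- apply (is_series_decr_1 (K := C_AbsRing) (V := C_NormedModule)).
  change (has_sum (fun n => u (S n)) (u 0%nat + l + - u 0%nat)).
  replace (u 0%nat + l + - u 0%nat) with l by ring. exact H.
- apply (is_series_incr_1 (K := C_AbsRing) (V := C_NormedModule)).
  change (has_sum u (l + u 0%nat)). rewrite Cplus_comm. exact H.
Qed.

Definition conv (a b : nat -> C) (n : nat) : C :=
  sum_n (G := C_AbelianMonoid) (fun k => a k * b (n - k)%nat) n.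

(** The real Cauchy product [is_series_mult] is applied to the four products of real and imaginary
    parts; the majorants [b] and [c] supply the absolute convergence that it demands. *)
Lemma has_sum_conv (u v : nat -> C) (b c : nat -> R) (l m : C) :
  has_sum u l -> has_sum v m ->
  (forall n, (Cmod (u n) <= b n)%R) -> ex_series b ->
  (forall n, (Cmod (v n) <= c n)%R) -> ex_series c ->
  has_sum (conv u v) (l * m).
Proof.
intros Hu Hv Hb Eb Hc Ec.
apply has_sum_parts in Hu. apply has_sum_parts in Hv.
destruct Hu as [Hu1 Hu2], Hv as [Hv1 Hv2].
assert (HI : forall a : C, (Rabs (Im a) <= Cmod a)%R)
  by (intro; eapply Rle_trans; [apply Rmax_r|apply Rmax_Cmod]).
assert (HA : forall (w : nat -> C) (d : nat -> R) (pr : C -> R),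
   (forall a, (Rabs (pr a) <= Cmod a)%R) ->
   (forall n, (Cmod (w n) <= d n)%R) -> ex_series d -> ex_series (fun n => Rabs (pr (w n)))).
{ intros w d pr Hpr Hw Hd.
  apply (ex_series_le (K := R_AbsRing) (V := R_CompleteNormedModule) _ d); [|exact Hd].
  intros n. change (Rabs (Rabs (pr (w n))) <= d n)%R. rewrite Rabs_Rabsolu.
  eapply Rle_trans; [apply Hpr|apply Hw]. }
assert (A1 := HA u b Re re_le_Cmod Hb Eb). assert (A2 := HA u b Im HI Hb Eb).
assert (A3 := HA v c Re re_le_Cmod Hc Ec). assert (A4 := HA v c Im HI Hc Ec).
apply has_sum_parts. rewrite re_mult, im_mult. split.
- assert (H := is_series_minus _ _ _ _ (is_series_mult _ _ _ _ Hu1 Hv1 A1 A3)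
    (is_series_mult _ _ _ _ Hu2 Hv2 A2 A4)).
  eapply is_series_ext; [|exact H]. intros n. cbv beta.
  rewrite <- !sum_n_Reals. unfold conv. rewrite (proj1 (sum_n_parts _ _)).
  change minus with Rminus. unfold Rminus.
  rewrite <- (Rmult_1_l (sum_n (fun k => Im (u k) * Im (v (n - k)%nat))%R n)).
  rewrite Ropp_mult_distr_l.
  rewrite <- (sum_n_mult_l (K := R_Ring)).
  rewrite <- (sum_n_plus (G := R_AbelianMonoid)).
  apply sum_n_ext. intros k. rewrite re_mult. unfold mult, plus. simpl. ring.
- assert (H := is_series_plus _ _ _ _ (is_series_mult _ _ _ _ Hu1 Hv2 A1 A4)
    (is_series_mult _ _ _ _ Hu2 Hv1 A2 A3)).
  eapply is_series_ext; [|exact H]. intros n. cbv beta.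
  rewrite <- !sum_n_Reals. unfold conv. rewrite (proj2 (sum_n_parts _ _)).
  rewrite <- (sum_n_plus (G := R_AbelianMonoid)).
  apply sum_n_ext. intros k. rewrite im_mult. unfold plus. simpl. ring.
Qed.

(** Equivalent to a positive radius of convergence. The exponent [S n] lets the single number [rho]
    serve both as ratio and as constant factor. *)
Definition geometric (a : nat -> C) : Prop :=
  exists rho : R, (1 <= rho)%R /\ forall n, (Cmod (a n) <= rho ^ S n)%R.

(** A total function, meaningful only where the series converges; for [geometric] coefficients this
    includes a neighbourhood of 0. *)
Definition psum (a : nat -> C) (z : C) : C :=
  (Series (fun n => Re (a n * z ^ n)), Series (fun n => Im (a n * z ^ n))).

Lemma psum_unique (a : nat -> C) (z l : C) :
  has_sum (fun n => a n * z ^ n) l -> l = psum a z.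
Proof.
intros H. apply has_sum_parts in H. destruct H as [H1 H2].
apply injective_projections; symmetry; apply is_series_unique; assumption.
Qed.

Lemma is_pseries_has_sum (a : nat -> C) (z l : C) :
  is_pseries (K := C_AbsRing) (V := C_NormedModule) a z l <->
  has_sum (fun n => a n * z ^ n) l.
Proof.
assert (E : forall n, pow_n (K := C_AbsRing) z n = z ^ n).
{ induction n; [reflexivity|]. simpl. rewrite IHn. reflexivity. }
split; apply is_series_ext; intros n; [|symmetry];
  change (pow_n (K := C_AbsRing) z n * a n = a n * z ^ n); rewrite (E n); apply Cmult_comm.
Qed.

Lemma ex_series_geom_half (c : R) : ex_series (fun n => c * (/ 2) ^ n)%R.
Proof.
exists (c * / (1 - / 2))%R.
apply (is_series_scal (K := R_AbsRing) (V := R_NormedModule) c).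
apply is_series_geom. rewrite Rabs_right; lra.
Qed.

(** On half of the disc guaranteed by [rho] the terms have a summable majorant free of [z]. *)
Lemma geometric_term_bound (a : nat -> C) (rho : R) (z : C) :
  (1 <= rho)%R -> (forall n, (Cmod (a n) <= rho ^ S n)%R) ->
  (Cmod z <= / (2 * rho))%R -> forall n, (Cmod (a n * z ^ n) <= rho * (/ 2) ^ n)%R.
Proof.
intros Hr Ha Hz n. rewrite Cmod_mult, Cmod_pow.
replace (rho * (/ 2) ^ n)%R with (rho ^ S n * (/ (2 * rho)) ^ n)%R.
- apply Rmult_le_compat; auto using Cmod_ge_0.
  + apply pow_le, Cmod_ge_0.
  + apply pow_incr. split; [apply Cmod_ge_0|exact Hz].
- rewrite Rinv_mult, Rpow_mult_distr, !pow_inv. simpl. field.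
  split; apply pow_nonzero; lra.
Qed.

Lemma geometric_convergence_disc (a : nat -> C) (rho : R) (z : C) :
  (1 <= rho)%R -> (forall n, (Cmod (a n) <= rho ^ S n)%R) ->
  (Cmod z <= / (2 * rho))%R -> has_sum (fun n => a n * z ^ n) (psum a z).
Proof.
intros Hr Ha Hz.
destruct (has_sum_exists (fun n => a n * z ^ n) (fun n => rho * (/ 2) ^ n)%R) as [l Hl].
- apply geometric_term_bound; assumption.
- apply ex_series_geom_half.
- rewrite <- (psum_unique _ _ _ Hl). exact Hl.
Qed.

Lemma near_disc (rho : R) : (1 <= rho)%R -> near 0 (fun z => (Cmod z <= / (2 * rho))%R).
Proof.
intros Hr. generalize (near_small (/ (2 * rho))).
intros H. eapply filter_imp; [|apply H; apply Rinv_0_lt_compat; lra].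
intros y Hy. lra.
Qed.

Lemma near_psum (a : nat -> C) :
  geometric a -> near 0 (fun z => has_sum (fun n => a n * z ^ n) (psum a z)).
Proof.
intros [rho [Hr Ha]]. generalize (near_disc rho Hr). apply filter_imp.
intros z. apply geometric_convergence_disc; assumption.
Qed.

Lemma geometric_intro (a : nat -> C) (M rho : R) :
  (forall n, (Cmod (a n) <= M * rho ^ n)%R) -> (0 <= rho)%R -> geometric a.
Proof.
intros H Hrho. set (s := Rmax 1 (Rmax M rho)).
assert (H1 : (1 <= s)%R) by apply Rmax_l.
assert (HM : (M <= s)%R) by (eapply Rle_trans; [apply Rmax_l|apply Rmax_r]).
assert (Hr : (rho <= s)%R) by (eapply Rle_trans; [apply (Rmax_r M)|apply Rmax_r]).
exists s. split; [exact H1|]. intros n. eapply Rle_trans; [apply H|]. simpl.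
apply Rle_trans with (s * rho ^ n)%R.
- apply Rmult_le_compat_r; [apply pow_le|]; assumption.
- apply Rmult_le_compat_l; [lra|]. apply pow_incr. lra.
Qed.

(** Abel's argument: the terms of a convergent series are bounded. It is what gives the coefficients
    of an arbitrary [series_solution] a positive radius of convergence. *)
Lemma geometric_of_has_sum (a : nat -> C) (z l : C) :
  z <> 0 -> has_sum (fun n => a n * z ^ n) l -> geometric a.
Proof.
intros Hz H.
assert (Hm := proj1 (Cmod_gt_0 _) Hz).
assert (HB : exists B, forall n, (Cmod (a n * z ^ n) <= B)%R).
{ apply has_sum_parts in H. destruct H as [H1 H2].
  pose proof (ex_series_lim_0 _ (ex_intro _ _ H1)) as L1.
  pose proof (ex_series_lim_0 _ (ex_intro _ _ H2)) as L2.
  assert (Hbd : forall u : nat -> R, is_lim_seq u 0 -> exists B, forall n, (Rabs (u n) <= B)%R).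
  { intros u Hu. apply is_lim_seq_Reals in Hu.
    destruct (maj_by_pos u (exist _ 0%R Hu)) as [B [_ HB]]. exists B. exact HB. }
  destruct (Hbd _ L1) as [B1 HB1], (Hbd _ L2) as [B2 HB2].
  exists (B1 + B2)%R. intros n. specialize (HB1 n). specialize (HB2 n).
  set (w := a n * z ^ n) in *.
  replace w with (Re w + Ci * Im w)
    by (apply injective_projections; simpl; unfold Re, Im; ring).
  eapply Rle_trans; [apply Cmod_triangle|].
  rewrite Cmod_mult, !Cmod_R, Cmod_Ci. lra. }
destruct HB as [B HB].
apply geometric_intro with B (/ Cmod z)%R.
- intros n. specialize (HB n). rewrite Cmod_mult, Cmod_pow in HB.
  rewrite pow_inv.
  assert (Hp : (0 < Cmod z ^ n)%R) by (apply pow_lt; exact Hm).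
  apply Rmult_le_reg_r with (Cmod z ^ n)%R; [exact Hp|].
  replace (B * / Cmod z ^ n * Cmod z ^ n)%R with B by (field; lra). exact HB.
- left. apply Rinv_0_lt_compat. exact Hm.
Qed.

(** * Operations on coefficient sequences and their sums *)

Definition sadd (a b : nat -> C) (n : nat) : C := a n + b n.
Definition sscal (c : C) (a : nat -> C) (n : nat) : C := c * a n.
Definition sshift (a : nat -> C) (n : nat) : C :=
  match n with O => 0 | S m => a m end.
Definition stail (a : nat -> C) (n : nat) : C := a (S n).
Definition sder (a : nat -> C) (n : nat) : C := INR (S n) * a (S n).

(** Lets the factor [n + 1] produced by differentiation or convolution be absorbed by doubling the
    ratio of a geometric bound. *)
Lemma INR_S_le_pow2 n : (INR (S n) <= 2 ^ n)%R.
Proof.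
induction n; [simpl; lra|]. rewrite S_INR. simpl pow.
assert (1 <= 2 ^ n)%R by (apply pow_R1_Rle; lra). lra.
Qed.

Lemma Cmod_sum_n (u : nat -> C) (B : R) n :
  (forall k, (k <= n)%nat -> (Cmod (u k) <= B)%R) ->
  (Cmod (sum_n (G := C_AbelianMonoid) u n) <= INR (S n) * B)%R.
Proof.
induction n; intros H.
- rewrite sum_O. simpl. rewrite Rmult_1_l. apply H. lia.
- rewrite sum_Sn, S_INR. eapply Rle_trans; [apply Cmod_triangle|].
  assert (H1 := IHn (fun k Hk => H k (le_S _ _ Hk))). assert (H2 := H (S n) (le_n _)). lra.
Qed.

Lemma geometric_common (a b : nat -> C) :
  geometric a -> geometric b -> exists rho, (1 <= rho)%R /\
    (forall n, (Cmod (a n) <= rho ^ S n)%R) /\ (forall n, (Cmod (b n) <= rho ^ S n)%R).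
Proof.
intros [r [Hr Ha]] [s [Hs Hb]]. exists (Rmax r s).
assert (H1 := Rmax_l r s). assert (H2 := Rmax_r r s). split; [lra|]. split; intros n.
- eapply Rle_trans; [apply Ha|]. apply pow_incr. lra.
- eapply Rle_trans; [apply Hb|]. apply pow_incr. lra.
Qed.

Lemma geometric_ext (a b : nat -> C) :
  (forall n, a n = b n) -> geometric a -> geometric b.
Proof.
intros E [r [Hr Ha]]. exists r. split; [exact Hr|]. intros n. rewrite <- E. apply Ha.
Qed.

Lemma geometric_sadd (a b : nat -> C) : geometric a -> geometric b -> geometric (sadd a b).
Proof.
intros Ga Gb. destruct (geometric_common a b Ga Gb) as [r [Hr [Ha Hb]]].
apply geometric_intro with (2 * r)%R r; [|lra]. intros n.
eapply Rle_trans; [apply Cmod_triangle|].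
specialize (Ha n). specialize (Hb n). simpl in Ha, Hb. lra.
Qed.

Lemma geometric_sscal (c : C) (a : nat -> C) : geometric a -> geometric (sscal c a).
Proof.
intros [r [Hr Ha]]. apply geometric_intro with (Cmod c * r)%R r; [|lra]. intros n.
unfold sscal. rewrite Cmod_mult, Rmult_assoc.
apply Rmult_le_compat_l; [apply Cmod_ge_0|apply Ha].
Qed.

Lemma geometric_sshift (a : nat -> C) : geometric a -> geometric (sshift a).
Proof.
intros [r [Hr Ha]]. exists r. split; [exact Hr|]. intros [|n]; simpl.
- rewrite Cmod_0. lra.
- eapply Rle_trans; [apply Ha|].
  assert (0 <= r ^ S n)%R by (apply pow_le; lra). simpl in *. nra.
Qed.

Lemma geometric_stail (a : nat -> C) : geometric a -> geometric (stail a).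
Proof.
intros [r [Hr Ha]]. apply geometric_intro with (r * r)%R r; [|lra]. intros n.
specialize (Ha (S n)). simpl in Ha. unfold stail. lra.
Qed.

Lemma geometric_sder (a : nat -> C) : geometric a -> geometric (sder a).
Proof.
intros [r [Hr Ha]]. apply geometric_intro with (r * r)%R (2 * r)%R; [|lra]. intros n.
unfold sder. rewrite Cmod_mult, Cmod_R, Rabs_right by (apply Rle_ge, pos_INR).
rewrite Rpow_mult_distr.
replace (r * r * (2 ^ n * r ^ n))%R with (2 ^ n * r ^ S (S n))%R by (simpl; ring).
apply Rmult_le_compat; auto using pos_INR, Cmod_ge_0, INR_S_le_pow2.
Qed.

Lemma geometric_conv (a b : nat -> C) : geometric a -> geometric b -> geometric (conv a b).
Proof.
intros Ga Gb. destruct (geometric_common a b Ga Gb) as [r [Hr [Ha Hb]]].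
apply geometric_intro with (r * r)%R (2 * r)%R; [|lra]. intros n.
unfold conv. eapply Rle_trans; [apply Cmod_sum_n with (B := (r ^ S (S n))%R)|].
- intros k Hk. rewrite Cmod_mult.
  replace (r ^ S (S n))%R with (r ^ S k * r ^ S (n - k))%R
    by (rewrite <- pow_add; f_equal; lia).
  apply Rmult_le_compat; auto using Cmod_ge_0.
- rewrite Rpow_mult_distr.
  replace (r * r * (2 ^ n * r ^ n))%R with (2 ^ n * r ^ S (S n))%R by (simpl; ring).
  apply Rmult_le_compat_r; [apply pow_le; lra|apply INR_S_le_pow2].
Qed.

Lemma psum_ext (a b : nat -> C) z : (forall n, a n = b n) -> psum a z = psum b z.
Proof.
intros E. apply injective_projections; apply Series_ext; intros n; rewrite E; reflexivity.
Qed.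

Lemma near_psum_sadd (a b : nat -> C) : geometric a -> geometric b ->
  near 0 (fun z => psum (sadd a b) z = psum a z + psum b z).
Proof.
intros Ga Gb. refine (near_mp _ _ _ (near_psum a Ga) _).
generalize (near_psum b Gb). apply filter_imp. intros z Hb Ha.
symmetry. apply psum_unique. eapply has_sum_ext; [|exact (has_sum_plus _ _ _ _ Ha Hb)].
intros n. unfold sadd. cbv beta. ring.
Qed.

Lemma near_psum_sscal (c : C) (a : nat -> C) : geometric a ->
  near 0 (fun z => psum (sscal c a) z = c * psum a z).
Proof.
intros Ga. generalize (near_psum a Ga). apply filter_imp. intros z Ha.
symmetry. apply psum_unique. eapply has_sum_ext; [|exact (has_sum_scal c _ _ Ha)].
intros n. unfold sscal. cbv beta. ring.
Qed.

Lemma near_psum_sshift (a : nat -> C) : geometric a ->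
  near 0 (fun z => psum (sshift a) z = z * psum a z).
Proof.
intros Ga. generalize (near_psum a Ga). apply filter_imp. intros z Ha.
symmetry. apply psum_unique.
replace (z * psum a z) with (sshift a 0 * z ^ 0 + z * psum a z) by (simpl; ring).
apply (has_sum_cons (fun n => sshift a n * z ^ n)).
eapply has_sum_ext; [|exact (has_sum_scal z _ _ Ha)].
intros n. simpl. ring.
Qed.

Lemma near_psum_stail (a : nat -> C) : geometric a ->
  near 0 (fun z => psum a z = a 0%nat + z * psum (stail a) z).
Proof.
intros Ga. generalize (near_psum (stail a) (geometric_stail a Ga)). apply filter_imp.
intros z Ha. symmetry. apply psum_unique.
replace (a 0%nat + z * psum (stail a) z)
  with (a 0%nat * z ^ 0 + z * psum (stail a) z) by (simpl; ring).
apply (has_sum_cons (fun n => a n * z ^ n)).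
eapply has_sum_ext; [|exact (has_sum_scal z _ _ Ha)].
intros n. unfold stail. simpl. ring.
Qed.

Lemma near_psum_conv (a b : nat -> C) : geometric a -> geometric b ->
  near 0 (fun z => psum (conv a b) z = psum a z * psum b z).
Proof.
intros Ga Gb. destruct (geometric_common a b Ga Gb) as [r [Hr [Ha Hb]]].
generalize (near_disc r Hr). apply filter_imp. intros z Hz.
symmetry. apply psum_unique.
eapply has_sum_ext.
2:{ apply (has_sum_conv (fun n => a n * z ^ n) (fun n => b n * z ^ n)
     (fun n => r * (/ 2) ^ n)%R (fun n => r * (/ 2) ^ n)%R).
    - apply geometric_convergence_disc with r; assumption.
    - apply geometric_convergence_disc with r; assumption.
    - apply geometric_term_bound; assumption.
    - apply ex_series_geom_half.
    - apply geometric_term_bound; assumption.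
    - apply ex_series_geom_half. }
intros n. unfold conv. cbv beta.
rewrite <- (sum_n_mult_r (K := C_Ring)).
unfold sum_n. apply sum_n_m_ext_loc. intros k [_ Hk].
change mult with Cmult. replace (z ^ n) with (z ^ k * z ^ (n - k)).
{ match goal with |- @eq _ ?x ?y => change (@eq C x y) end. ring. }
rewrite <- Cpow_add_r. f_equal. lia.
Qed.

Lemma psum_0 (a : nat -> C) : psum a 0 = a 0%nat.
Proof.
symmetry. apply psum_unique.
assert (H := is_pseries_0 (K := C_AbsRing) (V := C_NormedModule) a).
apply is_pseries_has_sum in H. exact H.
Qed.

(** The Taylor remainder of order [m + 1] is [y] times that of order [m] plus [m z^(m-1) (y - z)^2].
    The bound is brought to the form [(2 R)^n] times a factor free of [n], which can be summed
    against geometric coefficients. *)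
Lemma power_second_order (y z : C) (R : R) n :
  (0 < R)%R -> (Cmod y <= R)%R -> (Cmod z <= R)%R ->
  (Cmod (y ^ n - z ^ n - (y - z) * (INR n * z ^ pred n))
     <= (2 * R) ^ n * (Cmod (y - z) ^ 2 / R ^ 2))%R.
Proof.
intros HR Hy Hz.
assert (Hh : (0 <= Cmod (y - z) ^ 2 / R ^ 2)%R).
{ apply Rmult_le_pos; [apply pow2_ge_0|]. left. apply Rinv_0_lt_compat, pow_lt, HR. }
induction n.
- simpl. replace (1 - 1 - (y - z) * (0 * 1)) with (RtoC 0) by ring.
  rewrite Cmod_0. simpl in Hh. lra.
- destruct n as [|n].
  { simpl. replace (y * 1 - z * 1 - (y - z) * (1 * 1)) with (RtoC 0) by ring.
    rewrite Cmod_0. apply Rmult_le_pos; [lra|]. exact Hh. }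
  set (m := S n) in *.
  replace (y ^ S m - z ^ S m - (y - z) * (INR (S m) * z ^ pred (S m)))
    with (y * (y ^ m - z ^ m - (y - z) * (INR m * z ^ pred m))
          + INR m * z ^ n * ((y - z) * (y - z))).
  2:{ rewrite S_INR, RtoC_plus. unfold m. simpl pred. simpl Cpow. ring. }
  eapply Rle_trans; [apply Cmod_triangle|]. rewrite !Cmod_mult.
  rewrite Cmod_pow, Cmod_R, (Rabs_right (INR m)) by (apply Rle_ge, pos_INR).
  set (h := Cmod (y - z)) in *.
  assert (H1 : (Cmod y * Cmod (y ^ m - z ^ m - (y - z) * (INR m * z ^ pred m))
     <= R * ((2 * R) ^ m * (h ^ 2 / R ^ 2)))%R).
  { apply Rmult_le_compat; auto using Cmod_ge_0. }
  assert (H2 : (INR m * Cmod z ^ n * (h * h) <= 2 ^ n * R ^ n * (h * h))%R).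
  { apply Rmult_le_compat_r; [apply Rle_0_sqr|].
    apply Rmult_le_compat; [apply pos_INR|apply pow_le, Cmod_ge_0|apply INR_S_le_pow2|].
    apply pow_incr. split; [apply Cmod_ge_0|exact Hz]. }
  eapply Rle_trans; [apply Rplus_le_compat; [exact H1|exact H2]|].
  replace (2 ^ n * R ^ n * (h * h))%R with ((2 * R) ^ n * R ^ 2 * (h ^ 2 / R ^ 2))%R
    by (rewrite Rpow_mult_distr; field; lra).
  unfold m. simpl pow at 1 4.
  assert (0 <= (2 * R) ^ n)%R by (apply pow_le; lra).
  rewrite <- Rmult_assoc, <- Rmult_plus_distr_r.
  apply Rmult_le_compat_r; [exact Hh|]. simpl. nra.
Qed.

Lemma near_psum_derivative (a : nat -> C) : geometric a ->
  near 0 (fun z => has_derivative (psum a) z (psum (sder a) z)).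
Proof.
intros Ga. generalize (near_psum (sder a) (geometric_sder a Ga)). intros HD.
destruct Ga as [r [Hr Ha]].
assert (HR0 : (0 < / (4 * r))%R) by (apply Rinv_0_lt_compat; lra).
(* With this radius [r * (2 * R)] is 1/2, so the remainders of the terms are dominated by a series
   of ratio 1/2, whose sum is the [K * Cmod (y - z) ^ 2] below. *)
set (R := (/ (4 * r))%R) in *.
assert (HR2 : (R <= / (2 * r))%R) by (apply Rinv_le_contravar; lra).
refine (near_mp _ _ _ HD _). generalize (near_small R HR0). apply filter_imp.
intros z Hz HDz. apply derivative_Cmod. intros eps Heps.
set (K := (2 * r / R ^ 2)%R).
assert (HK : (0 < K)%R).
{ apply Rdiv_lt_0_compat; [lra|]. apply pow_lt, HR0. }
refine (near_mp _ _ _ (near_ball z (eps / K) _) _); [apply Rdiv_lt_0_compat; assumption|].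
generalize (near_ball z (R - Cmod z) ltac:(lra)). apply filter_imp.
intros y Hy1 Hy2.
assert (Hy : (Cmod y <= R)%R).
{ replace y with ((y - z) + z) by ring. eapply Rle_trans; [apply Cmod_triangle|lra]. }
assert (Sy := geometric_convergence_disc a r y Hr Ha ltac:(lra)).
assert (Sz := geometric_convergence_disc a r z Hr Ha ltac:(lra)).
assert (SD : has_sum (fun n => a n * (INR n * z ^ pred n)) (psum (sder a) z)).
{ replace (psum (sder a) z) with (a 0%nat * (INR 0 * z ^ pred 0) + psum (sder a) z)
    by (simpl; ring).
  apply (has_sum_cons (fun n => a n * (INR n * z ^ pred n))).
  eapply has_sum_ext; [|exact HDz]. intros n. unfold sder. simpl pred. ring. }
assert (ST := has_sum_plus _ _ _ _ Sy (has_sum_plus _ _ _ _ (has_sum_scal (-(1)) _ _ Sz)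
  (has_sum_scal (-(1) * (y - z)) _ _ SD))).
apply Rle_trans with (K * Cmod (y - z) ^ 2)%R.
- replace (psum a y - psum a z - (y - z) * psum (sder a) z) with
   (psum a y + (- (1) * psum a z + - (1) * (y - z) * psum (sder a) z)) by ring.
  eapply (has_sum_bound _ _ (fun n => (r * (Cmod (y - z) ^ 2 / R ^ 2)) * (/ 2) ^ n)%R);
    [|exact ST|].
  + intros n. cbv beta.
    replace (a n * y ^ n + (- (1) * (a n * z ^ n) + - (1) * (y - z) * (a n * (INR n * z ^ pred n))))
      with (a n * (y ^ n - z ^ n - (y - z) * (INR n * z ^ pred n))) by ring.
    rewrite Cmod_mult.
    replace (r * (Cmod (y - z) ^ 2 / R ^ 2) * (/ 2) ^ n)%R
      with (r ^ S n * ((2 * R) ^ n * (Cmod (y - z) ^ 2 / R ^ 2)))%R.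
    * apply Rmult_le_compat; auto using Cmod_ge_0.
      apply power_second_order; auto; lra.
    * replace (/ 2)%R with (r * (2 * R))%R by (unfold R; field; lra).
      rewrite (Rpow_mult_distr r). simpl. field. lra.
  + replace (K * Cmod (y - z) ^ 2)%R with
      ((r * (Cmod (y - z) ^ 2 / R ^ 2)) * / (1 - / 2))%R by (unfold K; field; lra).
    apply (is_series_scal (K := R_AbsRing) (V := R_NormedModule)).
    apply is_series_geom. rewrite Rabs_right; lra.
- replace (K * Cmod (y - z) ^ 2)%R with ((K * Cmod (y - z)) * Cmod (y - z))%R by ring.
  apply Rmult_le_compat_r; [apply Cmod_ge_0|].
  replace eps with (K * (eps / K))%R by (field; lra).
  apply Rmult_le_compat_l; lra.
Qed.

(** A nonzero constant term would keep the sum away from 0 near 0, where [V] has points. Once it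
    vanishes, division by [z], legitimate on [V], replaces [a] by [stail a]. *)
Lemma identity_theorem (V : C -> Prop) (a : nat -> C) :
  ~ V 0 -> (forall P, near 0 P -> exists z, V z /\ P z) ->
  geometric a -> near 0 (fun z => V z -> psum a z = 0) -> forall n, a n = 0.
Proof.
intros V0 HV Ga Hz n. revert a Ga Hz.
assert (H0 : forall a, geometric a -> near 0 (fun z => V z -> psum a z = 0) -> a 0%nat = 0).
{ intros a Ga Hz. destruct (Ceq_dec (a 0%nat) 0) as [E|E]; [exact E|exfalso].
  assert (HN : near 0 (fun z => psum a z <> 0)).
  { refine (derivative_nonzero_near _ _ _ (locally_singleton _ _ (near_psum_derivative a Ga)) _).
    rewrite psum_0. exact E. }
  destruct (HV _ (filter_and _ _ Hz HN)) as [z [H1 [H2 H3]]]. auto. }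
induction n as [|n IH]; intros a Ga Hz; [auto|].
change (a (S n)) with (stail a n). apply IH; [apply geometric_stail, Ga|].
refine (near_mp _ _ _ Hz _). generalize (near_psum_stail a Ga). apply filter_imp.
intros z E1 E2 Vz. specialize (E2 Vz). rewrite (H0 a Ga Hz), E2 in E1.
destruct (Ceq_dec (psum (stail a) z) 0) as [E|E]; [exact E|exfalso].
apply (Cmult_neq_0 z (psum (stail a) z)).
- intros Ez. subst z. exact (V0 Vz).
- exact E.
- rewrite E1. ring.
Qed.

(** * Painlevé II near a zero *)

(** Course-of-values recursion: [hist n] is correct up to index [n] and arbitrary beyond. The
    hypothesis that [step n] reads only entries up to [n] makes the rest harmless. *)
Lemma strong_recursion {X : Type} (x0 : X) (step : nat -> (nat -> X) -> X) :
  (forall n h h', (forall k, (k <= n)%nat -> h k = h' k) -> step n h = step n h') ->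
  exists y, y 0%nat = x0 /\ forall n, y (S n) = step n y.
Proof.
intros Hext.
set (hist := fix hist n : nat -> X := match n with
  | O => fun _ => x0
  | S m => fun k => if Nat.leb k m then hist m k else step m (hist m) end).
assert (Hh : forall n k, (k <= n)%nat -> hist n k = hist k k).
{ induction n; intros k Hk; [replace k with 0%nat by lia; reflexivity|].
  destruct (Nat.eq_dec k (S n)) as [->|E]; [reflexivity|].
  rewrite <- IHn by lia. simpl. replace (Nat.leb k n) with true; [reflexivity|].
  symmetry. apply Nat.leb_le. lia. }
exists (fun n => hist n n). split; [reflexivity|]. intros n.
transitivity (step n (hist n)).
- change (hist (S n) (S n)) with
    (if Nat.leb (S n) n then hist n (S n) else step n (hist n)).
  rewrite (proj2 (Nat.leb_gt (S n) n)) by lia. reflexivity.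
- apply Hext. intros k Hk. apply Hh, Hk.
Qed.

Lemma conv_ext (a b a' b' : nat -> C) n :
  (forall k, (k <= n)%nat -> a k = a' k) -> (forall k, (k <= n)%nat -> b k = b' k) ->
  conv a b n = conv a' b' n.
Proof.
intros Ha Hb. unfold conv, sum_n. apply sum_n_m_ext_loc. intros k [_ Hk].
rewrite Ha, Hb by lia. reflexivity.
Qed.

Lemma Cmod_conv (a b : nat -> C) (r A B : R) n :
  (forall k, (k <= n)%nat -> (Cmod (a k) <= A * r ^ k)%R) ->
  (forall k, (k <= n)%nat -> (Cmod (b k) <= B * r ^ k)%R) ->
  (Cmod (conv a b n) <= INR (S n) * (A * B * r ^ n))%R.
Proof.
intros Ha Hb. apply Cmod_sum_n. intros k Hk. rewrite Cmod_mult.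
replace (A * B * r ^ n)%R with ((A * r ^ k) * (B * r ^ (n - k)))%R.
- apply Rmult_le_compat; auto using Cmod_ge_0. apply Hb. lia.
- replace n with (k + (n - k))%nat at 2 by lia. rewrite pow_add. ring.
Qed.

Lemma INR_neq_0 n : RtoC (INR (S n)) <> 0.
Proof.
intros E. apply RtoC_inj in E. assert (H := lt_0_INR (S n) (Nat.lt_0_succ n)). lra.
Qed.

Definition painleve_rhs (t : C) (a : nat -> C) : nat -> C :=
  sadd (sscal 2 (conv a (conv a a))) (sadd (sscal t a) (sshift a)).

(** The cubic convolution has [(n + 1)(n + 2) / 2] terms, so the factor [(n + 1)(n + 2)]
    of the recursion absorbs it and [|Q n| <= r ^ n] propagates. *)
Lemma painleve_formal_solution (t q1 : C) :
  exists Q, geometric Q /\ Q 0%nat = 0 /\ Q 1%nat = q1 /\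
    forall n, sder (sder Q) n = painleve_rhs t Q n.
Proof.
destruct (strong_recursion (RtoC 0) (fun n h => match n with O => q1
   | S m => painleve_rhs t h m / (INR (S m) * INR (S (S m))) end)) as [Q [Q0 QS]].
{ intros [|m] h h' H; [reflexivity|]. f_equal. unfold painleve_rhs, sadd, sscal.
  rewrite (conv_ext h _ h' (conv h' h')); [|intros; apply H; lia|].
  2:{ intros k Hk. apply conv_ext; intros; apply H; lia. }
  rewrite H by lia. do 2 f_equal. destruct m; [reflexivity|]. simpl. apply H. lia. }
exists Q.
assert (HQ : forall n, sder (sder Q) n = painleve_rhs t Q n).
{ intros n. unfold sder. rewrite (QS (S n)). field. split; apply INR_neq_0. }
split; [|split; [exact Q0|split; [exact (QS 0%nat)|exact HQ]]].
(* Large enough for [Cmod q1 <= r] at index 1 and for [3 + Cmod t <= r * r] in the recursion, where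
   2 comes from the cubic term, [Cmod t] from [t q] and 1 from [z q]. *)
set (r := (3 + Cmod t + Cmod q1)%R).
assert (Ht := Cmod_ge_0 t). assert (Hq := Cmod_ge_0 q1).
assert (Hr : (1 <= r)%R) by (unfold r; lra).
apply geometric_intro with 1%R r; [|lra].
intros n. rewrite Rmult_1_l.
induction n as [n IH] using lt_wf_ind.
destruct n as [|[|m]].
{ rewrite Q0, Cmod_0. simpl. lra. }
{ rewrite (QS 0%nat). simpl. unfold r. lra. }
assert (IH' : forall k, (k <= m)%nat -> (Cmod (Q k) <= 1 * r ^ k)%R)
  by (intros; rewrite Rmult_1_l; apply IH; lia).
assert (Hm : (0 < INR (S m))%R) by (apply lt_0_INR; lia).
assert (Hp : (0 < r ^ m)%R) by (apply pow_lt; lra).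
assert (H3 : (Cmod (conv Q (conv Q Q) m) <= INR (S m) * (1 * INR (S m) * r ^ m))%R).
{ apply Cmod_conv; [exact IH'|]. intros k Hk.
  eapply Rle_trans; [apply Cmod_conv with (r := r) (A := 1%R) (B := 1%R); intros; apply IH'; lia|].
  rewrite !Rmult_1_l. apply Rmult_le_compat_r; [apply pow_le; lra|]. apply le_INR. lia. }
assert (H1 : (Cmod (sshift Q m) <= r ^ m)%R).
{ destruct m as [|m]; simpl sshift; [rewrite Cmod_0; simpl; lra|].
  eapply Rle_trans; [apply IH'; lia|]. rewrite Rmult_1_l. apply Rle_pow; [lra|lia]. }
assert (HB : (Cmod (painleve_rhs t Q m) <= INR (S m) * INR (S (S m)) * r ^ S (S m))%R).
{ unfold painleve_rhs, sadd, sscal.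
  eapply Rle_trans; [apply Cmod_triangle|].
  eapply Rle_trans; [apply Rplus_le_compat_l, Cmod_triangle|].
  rewrite !Cmod_mult, Cmod_R, Rabs_right by lra.
  assert (H2 := IH' m (le_n _)). rewrite Rmult_1_l in H2, H3.
  assert (Hm1 : (1 <= INR (S m))%R) by (apply (le_INR 1); lia).
  rewrite (S_INR (S m)). set (x := INR (S m)) in *.
  assert (H4 : (Cmod t * Cmod (Q m) <= Cmod t * r ^ m)%R) by (apply Rmult_le_compat_l; lra).
  apply Rle_trans with ((2 * x * x + Cmod t + 1) * r ^ m)%R; [lra|].
  replace (x * (x + 1) * r ^ S (S m))%R with (x * (x + 1) * (r * r) * r ^ m)%R by (simpl; ring).
  apply Rmult_le_compat_r; [lra|].
  assert (Hrr : (3 + Cmod t <= r * r)%R) by (unfold r; nra).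
  apply Rle_trans with (x * (x + 1) * (3 + Cmod t))%R; [nra|].
  apply Rmult_le_compat_l; nra. }
rewrite QS. set (b := painleve_rhs t Q m) in *.
rewrite Cmod_div by (apply Cmult_neq_0; apply INR_neq_0).
rewrite Cmod_mult, !Cmod_R, !Rabs_right by (apply Rle_ge, pos_INR).
assert (Hm2 : (0 < INR (S (S m)))%R) by (apply lt_0_INR; lia).
assert (Hmm : (0 < INR (S m) * INR (S (S m)))%R) by (apply Rmult_lt_0_compat; assumption).
apply Rmult_le_reg_r with (INR (S m) * INR (S (S m)))%R; [exact Hmm|].
unfold Rdiv. rewrite Rmult_assoc, Rinv_l by lra. lra.
Qed.

Definition painleve_germ (t : C) (p p1 : C -> C) : Prop :=
  near 0 (fun z => has_derivative p z (p1 z) /\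
                   has_derivative p1 z (2 * p z ^ 3 + (t + z) * p z)).

Lemma painleve_formal_germ (t : C) (Q : nat -> C) :
  geometric Q -> (forall n, sder (sder Q) n = painleve_rhs t Q n) ->
  painleve_germ t (psum Q) (psum (sder Q)).
Proof.
intros G H. unfold painleve_germ.
assert (G2 := geometric_conv _ _ G G). assert (G3 := geometric_conv _ _ G G2).
assert (G4 := geometric_sadd _ _ (geometric_sscal t _ G) (geometric_sshift _ G)).
refine (near_mp _ _ _ (near_psum_derivative Q G) _).
refine (near_mp _ _ _ (near_psum_derivative _ (geometric_sder _ G)) _).
refine (near_mp _ _ _ (near_psum_sadd _ _ (geometric_sscal 2 _ G3) G4) _).
refine (near_mp _ _ _ (near_psum_sadd _ _ (geometric_sscal t _ G) (geometric_sshift _ G)) _).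
refine (near_mp _ _ _ (near_psum_sscal 2 _ G3) _).
refine (near_mp _ _ _ (near_psum_sscal t _ G) _).
refine (near_mp _ _ _ (near_psum_sshift _ G) _).
refine (near_mp _ _ _ (near_psum_conv _ _ G G2) _).
refine (near_mp _ _ _ (near_psum_conv _ _ G G) _).
apply filter_forall. intros z E1 E2 E3 E4 E5 E6 E7 D2 D1.
split; [exact D1|]. eapply derivative_eq; [exact D2|].
rewrite (psum_ext _ _ z H). unfold painleve_rhs.
rewrite E7, E6, E5, E4, E3, E2, E1. ring.
Qed.

Lemma derivative_bounded_near (f : C -> C) (z l : C) :
  has_derivative f z l -> near z (fun y => (Cmod (f y) <= Cmod (f z) + 1)%R).
Proof.
intros H. generalize (derivative_continuous f z l H 1 ltac:(lra)). apply filter_imp.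
intros y Hy. replace (f y) with ((f y - f z) + f z) by ring.
eapply Rle_trans; [apply Cmod_triangle|lra].
Qed.

Lemma halving_zero (x S : R) : (forall n, (x <= S * (/ 2) ^ n)%R) -> (x <= 0)%R.
Proof.
intros H.
assert (L : is_lim_seq (fun n => S * (/ 2) ^ n)%R (S * 0)%R).
{ apply (is_lim_seq_scal_l _ S 0%R). apply is_lim_seq_geom. rewrite Rabs_right; lra. }
rewrite Rmult_0_r in L.
exact (is_lim_seq_le (fun _ => x) _ x 0%R H (is_lim_seq_const x) L).
Qed.

(** On a small disc, the mean value inequality halves any bound on the
    differences [p - q] and [p1 - q1]. *)
Lemma painleve_germ_unique (t : C) (p p1 q q1 : C -> C) :
  painleve_germ t p p1 -> painleve_germ t q q1 -> p 0 = q 0 -> p1 0 = q1 0 ->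
  near 0 (fun z => p z = q z /\ p1 z = q1 z).
Proof.
intros Hp Hq E0 E1.
destruct (locally_singleton _ _ Hp) as [Dp Dp1].
destruct (locally_singleton _ _ Hq) as [Dq Dq1].
apply derivative_bounded_near in Dp. apply derivative_bounded_near in Dp1.
apply derivative_bounded_near in Dq. apply derivative_bounded_near in Dq1.
rewrite <- E0 in Dq. rewrite <- E1 in Dq1.
set (M := (Cmod (p 0) + 1)%R) in *. set (M1 := (Cmod (p1 0) + 1)%R) in *.
assert (HM : (0 < M)%R) by (generalize (Cmod_ge_0 (p 0)); unfold M; lra).
assert (HM1 : (0 < M1)%R) by (generalize (Cmod_ge_0 (p1 0)); unfold M1; lra).
assert (HA := filter_and _ _ (filter_and _ _ Hp Hq)
   (filter_and _ _ (filter_and _ _ Dp Dq) (filter_and _ _ Dp1 Dq1))).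
apply near_Cmod in HA. destruct HA as [d [Hd HA]].
(* [L] bounds [2 (p^2 + p q + q^2) + t + z] for values of modulus at most [M] and [|z| <= 1], so it
   is a Lipschitz constant of the right-hand side. The radius [e] with [4 L e <= 1] turns the factor
   2 of [mean_value_bound] into a halving. *)
set (L := (6 * M ^ 2 + Cmod t + 1)%R).
assert (HL : (1 <= L)%R).
{ generalize (Cmod_ge_0 t) (pow2_ge_0 M). unfold L. lra. }
set (e := Rmin (Rmin d 1) (/ (4 * L))).
assert (He : (0 < e)%R).
{ unfold e. repeat apply Rmin_glb_lt; try lra. apply Rinv_0_lt_compat. lra. }
assert (He1 : (e <= d)%R) by (eapply Rle_trans; [apply Rmin_l|apply Rmin_l]).
assert (He2 : (e <= 1)%R) by (eapply Rle_trans; [apply Rmin_l|apply Rmin_r]).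
assert (He3 : (4 * L * e <= 1)%R).
{ apply Rle_trans with (4 * L * / (4 * L))%R; [|right; field; lra].
  apply Rmult_le_compat_l; [lra|apply Rmin_r]. }
set (B := (2 * M + 2 * M1)%R).
assert (HS : forall n z, (Cmod z < e)%R ->
   (Cmod (p z - q z) <= B * (/ 2) ^ n)%R /\ (Cmod (p1 z - q1 z) <= B * (/ 2) ^ n)%R).
{ induction n as [|n IH]; intros z Hz.
  - destruct (HA z) as [_ [[B1 B2] [B3 B4]]]; [replace (z - 0) with z by ring; lra|].
    simpl. unfold Cminus, B.
    split; (eapply Rle_trans; [apply Cmod_triangle|]); rewrite Cmod_opp; lra.
  - set (S := (B * (/ 2) ^ n)%R) in *.
    assert (HS0 : (0 <= S)%R).
    { unfold S. apply Rmult_le_pos; [unfold B; lra|apply pow_le; lra]. }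
    replace (B * (/ 2) ^ Datatypes.S n)%R with (S / 2)%R by (unfold S; simpl; field).
    split.
    + assert (H := mean_value_bound (fun z => p z - q z) (fun z => p1 z - q1 z) z S).
      cbv beta in H. rewrite E0 in H. replace (q 0 - q 0) with (RtoC 0) in H by ring.
      replace (p z - q z - 0) with (p z - q z) in H by ring.
      eapply Rle_trans; [apply H|].
      * intros y Hy. destruct (HA y) as [[[F1 _] [F2 _]] _];
          [replace (y - 0) with y by ring; lra|].
        split; [apply derivative_minus; assumption|]. apply IH. lra.
      * assert (S * Cmod z <= S * e)%R by (apply Rmult_le_compat_l; lra). nra.
    + assert (H := mean_value_bound (fun z => p1 z - q1 z)
        (fun z => (2 * p z ^ 3 + (t + z) * p z) - (2 * q z ^ 3 + (t + z) * q z)) z (L * S)).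
      cbv beta in H. rewrite E1 in H. replace (q1 0 - q1 0) with (RtoC 0) in H by ring.
      replace (p1 z - q1 z - 0) with (p1 z - q1 z) in H by ring.
      eapply Rle_trans; [apply H|].
      * intros y Hy. destruct (HA y) as [[[_ F1] [_ F2]] [[B1 B2] _]];
          [replace (y - 0) with y by ring; lra|].
        split; [apply derivative_minus; assumption|].
        replace (2 * p y ^ 3 + (t + y) * p y - (2 * q y ^ 3 + (t + y) * q y))
          with ((2 * (p y * p y + (p y * q y + q y * q y)) + (t + y)) * (p y - q y)) by ring.
        rewrite Cmod_mult. apply Rmult_le_compat; auto using Cmod_ge_0; [|apply IH; lra].
        eapply Rle_trans; [apply Cmod_triangle|].
        rewrite Cmod_mult, Cmod_R, Rabs_right by lra.
        assert (P1 := Cmod_triangle (p y * p y) (p y * q y + q y * q y)).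
        assert (P2 := Cmod_triangle (p y * q y) (q y * q y)).
        assert (P3 := Cmod_triangle t y).
        rewrite !Cmod_mult in *.
        assert (G1 := Cmod_ge_0 (p y)). assert (G2 := Cmod_ge_0 (q y)).
        assert (Cmod (p y) * Cmod (p y) <= M * M)%R by (apply Rmult_le_compat; lra).
        assert (Cmod (p y) * Cmod (q y) <= M * M)%R by (apply Rmult_le_compat; lra).
        assert (Cmod (q y) * Cmod (q y) <= M * M)%R by (apply Rmult_le_compat; lra).
        unfold L. lra.
      * assert (HLS : (0 <= L * S)%R) by (apply Rmult_le_pos; lra).
        assert (L * S * Cmod z <= L * S * e)%R by (apply Rmult_le_compat_l; lra). nra. }
generalize (near_small e He). apply filter_imp. intros z Hz.
split; apply Ceq_minus, Cmod_eq_0; apply Rle_antisym; try apply Cmod_ge_0;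
  apply halving_zero with B; intros n; apply HS, Hz.
Qed.

Lemma painleve_solution_germ (U : C -> Prop) (q : C -> C) (t : C) :
  domain U -> painleve2_solution U q -> U t ->
  painleve_germ t (fun z => q (t + z)) (fun z => C_derive q (t + z)).
Proof.
intros [HU _] Hq Ut. unfold painleve_germ.
generalize (proj1 (near_shift t U) (HU t Ut)). apply filter_imp.
intros z Uz. destruct (Hq _ Uz) as [D1 [D2 E]]. split.
- apply (derivative_shift q). apply C_derive_spec, D1.
- rewrite <- E. apply (derivative_shift (C_derive q)). apply C_derive_spec, D2.
Qed.

Lemma painleve_zero_simple (U : C -> Prop) (q : C -> C) (t : C) :
  domain U -> painleve2_solution U q -> (exists s, U s /\ q s <> 0) -> U t ->
  q t = 0 -> C_derive q t <> 0.
Proof.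
intros HU Hq [s [Us Hs]] Ut q0 q1.
set (Z := fun y => q y = 0 /\ C_derive q y = 0).
assert (HZ : forall y, U y -> Z y -> near y Z).
{ intros y Uy [Z0 Z1]. apply near_shift.
  refine (painleve_germ_unique y _ _ (fun _ => 0) (fun _ => 0)
    (painleve_solution_germ U q y HU Hq Uy) _ _ _).
  - unfold painleve_germ. apply filter_forall. intros z. split; [apply derivative_const|].
    eapply derivative_eq; [apply derivative_const|]. ring.
  - rewrite Cplus_0_r. exact Z0.
  - rewrite Cplus_0_r. exact Z1. }
assert (HN : forall y, U y -> ~ Z y -> near y (fun y => ~ Z y)).
{ intros y Uy NZ. destruct (Hq y Uy) as [D1 [D2 _]].
  destruct (Ceq_dec (q y) 0) as [E|E].
  - assert (E1 : C_derive q y <> 0) by (intros E1; apply NZ; split; assumption).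
    generalize (derivative_nonzero_near _ _ _ (C_derive_spec _ _ D2) E1).
    apply filter_imp. intros x Hx [_ X]. auto.
  - generalize (derivative_nonzero_near _ _ _ (C_derive_spec _ _ D1) E).
    apply filter_imp. intros x Hx [X _]. auto. }
(* [domain] phrases connectedness with open subsets of the plane, so it is applied to the interiors
   of [Z] and of its complement, which together cover [U]. *)
destruct (proj2 HU (fun y => near y Z) (fun y => near y (fun y => ~ Z y)))
  as [z [_ [Hz1 Hz2]]].
- intros y Hy. apply near_near, Hy.
- intros y Hy. apply near_near, Hy.
- intros y Uy.
  destruct (Ceq_dec (q y) 0) as [E|E]; [destruct (Ceq_dec (C_derive q y) 0) as [F|F]|].
  + left. apply HZ; [exact Uy|split; assumption].
  + right. apply HN; [exact Uy|]. intros [_ X]. auto.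
  + right. apply HN; [exact Uy|]. intros [X _]. auto.
- exists t. split; [exact Ut|]. apply HZ; [exact Ut|split; assumption].
- exists s. split; [exact Us|]. apply HN; [exact Us|]. intros [X _]. auto.
- exact (locally_singleton _ _ Hz2 (locally_singleton _ _ Hz1)).
Qed.

Lemma painleve_zero_expansion (U : C -> Prop) (q : C -> C) (t : C) :
  domain U -> painleve2_solution U q -> (exists s, U s /\ q s <> 0) -> U t -> q t = 0 ->
  exists Q, geometric Q /\ Q 0%nat = 0 /\ Q 1%nat <> 0 /\ Q 2%nat = 0 /\
    near 0 (fun z => q (t + z) = psum Q z /\
                     has_derivative q (t + z) (psum (sder Q) z)).
Proof.
intros HU Hq Hs Ut q0.
destruct (painleve_formal_solution t (C_derive q t)) as [Q [G [Q0 [Q1 HQ]]]].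
exists Q. split; [exact G|]. split; [exact Q0|].
split; [rewrite Q1; apply (painleve_zero_simple U q t); assumption|]. split.
(* Index 0 of the recursion reads [2 Q_2 = 2 Q_0^3 + t Q_0], which is 0. *)
{ assert (H := HQ 0%nat). unfold painleve_rhs, sder, sadd, sscal, conv in H.
  rewrite sum_O, Q0 in H. simpl in H.
  replace (Q 2%nat) with (/ 2 * (1 * ((1 + 1)%R * Q 2%nat))).
  - rewrite H. ring.
  - rewrite RtoC_plus. field. }
assert (HG := painleve_solution_germ U q t HU Hq Ut).
refine (near_mp _ _ _ HG _).
generalize (painleve_germ_unique t _ _ _ _ HG (painleve_formal_germ t Q G HQ)). cbv beta.
intros H. rewrite Cplus_0_r, !psum_0, Q0 in H. unfold sder at 1 in H. rewrite Q1 in H.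
generalize (H q0 ltac:(simpl; ring)). apply filter_imp.
intros z [E1 E2] [D _]. split; [exact E1|]. rewrite <- E2.
apply (derivative_shift q) in D. exact D.
Qed.

(** * Regular linear systems *)

(** Meant for power series division, whose recursion has no factor [1 / (n + 1)] to pay for the
    number of terms: the terms themselves must decay away from the last one. *)
Lemma Cmod_sum_n_half (u : nat -> C) (B : R) n :
  (forall k, (k <= n)%nat -> (Cmod (u k) <= B * (/ 2) ^ (n - k))%R) ->
  (Cmod (sum_n (G := C_AbelianMonoid) u n) <= 2 * B)%R.
Proof.
revert B. induction n as [|n IH]; intros B H.
- rewrite sum_O. specialize (H 0%nat (le_n _)). simpl in H.
  assert (G := Cmod_ge_0 (u 0%nat)). lra.
- rewrite sum_Sn. eapply Rle_trans; [apply Cmod_triangle|].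
  assert (H1 := H (S n) (le_n _)). rewrite Nat.sub_diag in H1. simpl in H1.
  assert (H2 : (Cmod (sum_n (G := C_AbelianMonoid) u n) <= 2 * (B / 2))%R).
  { apply IH. intros k Hk. eapply Rle_trans; [apply H; lia|].
    replace (S n - k)%nat with (S (n - k)) by lia. simpl. lra. }
  change plus with Cplus. lra.
Qed.

Lemma power_series_division (g h : nat -> C) :
  geometric g -> geometric h -> g 0%nat <> 0 ->
  exists K, geometric K /\ forall n, conv K g n = h n.
Proof.
intros Gg Gh Hg0. destruct (geometric_common g h Gg Gh) as [r [Hr [Hg Hh]]].
destruct (strong_recursion (h 0%nat / g 0%nat) (fun n k =>
  (h (S n) - sum_n (G := C_AbelianMonoid) (fun j => k j * g (S n - j)%nat) n) / g 0%nat))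
  as [K [K0 KS]].
{ intros n k k' H. do 2 f_equal. apply sum_n_m_ext_loc. intros j [_ Hj].
  rewrite H by lia. reflexivity. }
exists K. split.
2:{ intros [|n]; unfold conv.
    - rewrite sum_O, K0. simpl. field. exact Hg0.
    - rewrite sum_Sn, Nat.sub_diag, KS. change plus with Cplus. field. exact Hg0. }
assert (Hm := proj1 (Cmod_gt_0 _) Hg0).
set (c := (/ Cmod (g 0%nat))%R).
assert (Hc : (0 < c)%R) by (apply Rinv_0_lt_compat; exact Hm).
(* [M] bounds the quotient of the constant terms. In [s], the summand [2 * r] gives the ratio
   [r / s <= 1/2] required by [Cmod_sum_n_half], and [2 * c * (r * r)] pays for the sum that it
   bounds. *)
set (M := (c * r)%R). assert (HM : (0 < M)%R) by (apply Rmult_lt_0_compat; lra).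
set (s := (2 * r + 2 * c * (r * r))%R).
assert (Hcr : (0 <= c * (r * r))%R) by (apply Rmult_le_pos; nra).
assert (Hs : (2 * r <= s)%R) by (unfold s; lra).
assert (Hdiv : forall x, Cmod (x / g 0%nat) = (c * Cmod x)%R).
{ intros x. rewrite Cmod_div by exact Hg0. unfold c, Rdiv. ring. }
apply geometric_intro with M s; [|lra].
intros n. induction n as [n IH] using lt_wf_ind. destruct n as [|n].
- rewrite K0, Hdiv. simpl. rewrite Rmult_1_r. unfold M.
  apply Rmult_le_compat_l; [lra|]. specialize (Hh 0%nat). simpl in Hh. lra.
- rewrite KS, Hdiv. assert (Hsn : (0 < s ^ n)%R) by (apply pow_lt; lra).
  assert (HS : (Cmod (sum_n (G := C_AbelianMonoid) (fun j => (K j * g (S n - j)%nat)%C) n)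
     <= 2 * (M * (r * r) * s ^ n))%R).
  { apply Cmod_sum_n_half. intros j Hj. rewrite Cmod_mult.
    apply Rle_trans with ((M * s ^ j) * r ^ S (S n - j))%R.
    { apply Rmult_le_compat; auto using Cmod_ge_0. apply IH. lia. }
    replace (S (S n - j)) with (2 + (n - j))%nat by lia.
    replace n with (j + (n - j))%nat at 2 by lia. rewrite !pow_add.
    replace (M * s ^ j * (r ^ 2 * r ^ (n - j)))%R
      with (M * (r * r) * s ^ j * r ^ (n - j))%R by ring.
    replace (M * (r * r) * (s ^ j * s ^ (n - j)) * (/ 2) ^ (n - j))%R
      with (M * (r * r) * s ^ j * (s * / 2) ^ (n - j))%R by (rewrite Rpow_mult_distr; ring).
    apply Rmult_le_compat_l.
    - apply Rmult_le_pos; [nra|apply pow_le; lra].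
    - apply pow_incr. lra. }
  assert (HT : (Cmod (h (S n)) <= r * (r * s ^ n))%R).
  { eapply Rle_trans; [apply Hh|]. simpl.
    assert (r ^ n <= s ^ n)%R by (apply pow_incr; lra).
    apply Rmult_le_compat_l; [lra|]. apply Rmult_le_compat_l; lra. }
  unfold Cminus. eapply Rle_trans;
    [apply Rmult_le_compat_l; [lra|apply Cmod_triangle]|]. rewrite Cmod_opp.
  apply Rle_trans with (c * (r * (r * s ^ n) + 2 * (M * (r * r) * s ^ n)))%R.
  { apply Rmult_le_compat_l; lra. }
  simpl. unfold s at 3, M.
  replace (c * (r * (r * s ^ n) + 2 * (c * r * (r * r) * s ^ n)))%R
    with ((c * r * s ^ n) * (r + 2 * c * (r * r)))%R by ring.
  replace (c * r * ((2 * r + 2 * c * (r * r)) * s ^ n))%R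
    with ((c * r * s ^ n) * (2 * r + 2 * c * (r * r)))%R by ring.
  apply Rmult_le_compat_l; [|lra]. apply Rmult_le_pos; [unfold M in HM; lra|lra].
Qed.

Definition system_rhs (M : unknown -> unknown -> nat -> C) (y : unknown -> nat -> C)
    (i : unknown) : nat -> C :=
  sadd (conv (M i mu_plus) (y mu_plus))
    (sadd (conv (M i mu_minus) (y mu_minus)) (conv (M i nu) (y nu))).

Definition regular_solution (M : unknown -> unknown -> nat -> C)
    (y : unknown -> nat -> C) : Prop :=
  forall i n, sder (y i) n = system_rhs M y i n.

Lemma system_rhs_ext M y y' i n :
  (forall x k, (k <= n)%nat -> y x k = y' x k) -> system_rhs M y i n = system_rhs M y' i n.
Proof.
intros H. unfold system_rhs, sadd.
rewrite (conv_ext (M i mu_plus) (y mu_plus) (M i mu_plus) (y' mu_plus)) by auto.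
rewrite (conv_ext (M i mu_minus) (y mu_minus) (M i mu_minus) (y' mu_minus)) by auto.
rewrite (conv_ext (M i nu) (y nu) (M i nu) (y' nu)) by auto. reflexivity.
Qed.

Lemma regular_solution_unique M y y' :
  regular_solution M y -> regular_solution M y' ->
  (forall x, y x 0%nat = y' x 0%nat) -> forall n x, y x n = y' x n.
Proof.
intros H H' H0 n. induction n as [n IH] using lt_wf_ind. intros x.
destruct n as [|n]; [apply H0|].
assert (E : sder (y x) n = sder (y' x) n).
{ rewrite H, H'. apply system_rhs_ext. intros z k Hk. apply IH. lia. }
unfold sder in E.
replace (y x (S n)) with (/ INR (S n) * (INR (S n) * y x (S n)))
  by (field; apply INR_neq_0).
rewrite E. field. apply INR_neq_0.
Qed.

Lemma regular_solution_exists M (y0 : unknown -> C) :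
  (forall i j, geometric (M i j)) ->
  exists y, (forall x, geometric (y x)) /\ (forall x, y x 0%nat = y0 x) /\
    regular_solution M y.
Proof.
intros GM.
(* The three sequences are built together as one sequence of vectors in [unknown -> C]; equality of
   such vectors is where functional extensionality enters. *)
destruct (strong_recursion (X := unknown -> C) y0 (fun n h => fun x =>
  (let y := fun x k => h k x in system_rhs M y x n) / INR (S n))) as [h [h0 hS]].
{ intros n k k' H.
  assert (E : forall x, system_rhs M (fun x j => k j x) x n
                = system_rhs M (fun x j => k' j x) x n).
  { intros x. apply system_rhs_ext. intros z j Hj. rewrite H by exact Hj. reflexivity. }
  cbv zeta. apply functional_extensionality. intros x.
  rewrite E. reflexivity. }
set (y := fun x k => h k x).
assert (HS : forall x n, y x (S n) = system_rhs M y x n / INR (S n)).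
{ intros x n. unfold y at 1. rewrite hS. reflexivity. }
assert (HM : exists r, (1 <= r)%R /\ forall i j n, (Cmod (M i j n) <= r * r ^ n)%R).
{ assert (HM1 : forall i, exists r, (1 <= r)%R /\ forall j n, (Cmod (M i j n) <= r ^ S n)%R).
  { intros i. destruct (GM i mu_plus) as [r1 [R1 H1]], (GM i mu_minus) as [r2 [R2 H2]],
      (GM i nu) as [r3 [R3 H3]].
    exists (r1 + r2 + r3)%R. split; [lra|].
    intros [| |] n; (eapply Rle_trans; [apply H1 || apply H2 || apply H3|]);
      apply pow_incr; lra. }
  destruct (HM1 mu_plus) as [r1 [R1 H1]], (HM1 mu_minus) as [r2 [R2 H2]],
      (HM1 nu) as [r3 [R3 H3]].
  exists (r1 + r2 + r3)%R. split; [lra|].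
  intros [| |] j n; (eapply Rle_trans; [apply H1 || apply H2 || apply H3|]);
      rewrite tech_pow_Rmult; apply pow_incr; lra. }
destruct HM as [r [Hr HM]].
set (B := (Cmod (y0 mu_plus) + Cmod (y0 mu_minus) + Cmod (y0 nu))%R).
assert (B1 := Cmod_ge_0 (y0 mu_plus)). assert (B2 := Cmod_ge_0 (y0 mu_minus)).
assert (B3 := Cmod_ge_0 (y0 nu)).
assert (HB : forall x, (Cmod (y0 x) <= B)%R) by (intros [| |]; unfold B; lra).
(* Each of the three convolutions costs a factor [r] and the number of its terms, which cancels
   against the division by [n + 1]. *)
set (s := (3 * r)%R).
assert (Hy : forall n x, (Cmod (y x n) <= B * s ^ n)%R).
{ intros n. induction n as [n IH] using lt_wf_ind. intros x.
  destruct n as [|n].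
  { unfold y. rewrite h0. simpl. rewrite Rmult_1_r. apply HB. }
  rewrite HS, Cmod_div by apply INR_neq_0.
  assert (Hn : (0 < INR (S n))%R) by (apply lt_0_INR; lia).
  rewrite Cmod_R, Rabs_right by lra.
  assert (HC : forall j, (Cmod (conv (M x j) (y j) n) <= INR (S n) * (r * B * s ^ n))%R).
  { intros j. apply Cmod_conv.
    - intros k Hk. eapply Rle_trans; [apply HM|]. apply Rmult_le_compat_l; [lra|].
      apply pow_incr. unfold s. lra.
    - intros k Hk. apply IH. lia. }
  apply Rmult_le_reg_r with (INR (S n)); [exact Hn|].
  unfold Rdiv. rewrite Rmult_assoc, Rinv_l, Rmult_1_r by lra.
  unfold system_rhs, sadd.
  eapply Rle_trans; [apply Cmod_triangle|].
  eapply Rle_trans; [apply Rplus_le_compat_l, Cmod_triangle|].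
  assert (C1 := HC mu_plus). assert (C2 := HC mu_minus). assert (C3 := HC nu).
  simpl pow. unfold s at 1. lra. }
exists y. split; [|split].
- intros x. apply geometric_intro with B s; [intros n; apply Hy|unfold s; lra].
- intros x. unfold y. rewrite h0. reflexivity.
- intros x n. unfold sder. rewrite HS. field. apply INR_neq_0.
Qed.

Lemma conv_sadd_r (a b c : nat -> C) n : conv a (sadd b c) n = conv a b n + conv a c n.
Proof.
unfold conv. change Cplus with (plus (G := C_AbelianMonoid)).
rewrite <- sum_n_plus. apply sum_n_ext. intros k. unfold sadd.
change plus with Cplus. match goal with |- @eq _ ?x ?y => change (@eq C x y) end. ring.
Qed.

Lemma conv_sscal_r (a b : nat -> C) (c : C) n : conv a (sscal c b) n = c * conv a b n.
Proof.
unfold conv. change Cmult with (mult (K := C_Ring)) at 2.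
rewrite <- (sum_n_mult_l (K := C_Ring)). apply sum_n_ext. intros k. unfold sscal.
change mult with Cmult. match goal with |- @eq _ ?x ?y => change (@eq C x y) end. ring.
Qed.

Lemma regular_solution_combination M y y' (c : C) :
  regular_solution M y -> regular_solution M y' ->
  regular_solution M (fun x => sadd (y x) (sscal c (y' x))).
Proof.
intros H H' i n.
replace (system_rhs M (fun x => sadd (y x) (sscal c (y' x))) i n)
  with (system_rhs M y i n + c * system_rhs M y' i n).
- rewrite <- H, <- H'. unfold sder, sadd, sscal. ring.
- assert (E : forall a b n, sadd a b n = a n + b n) by reflexivity.
  unfold system_rhs. rewrite !E, !conv_sadd_r, !conv_sscal_r. ring.
Qed.

(** * Power series paired with the functions they represent near 0 *)

Definition sconst (c : C) (n : nat) : C := match n with O => c | S _ => 0 end.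

Definition germ (a : nat -> C) (F : C -> C) : Prop :=
  geometric a /\ near 0 (fun z => psum a z = F z).

Lemma germ_psum (a : nat -> C) : geometric a -> germ a (psum a).
Proof. intros G. split; [exact G|]. apply filter_forall. reflexivity. Qed.

Lemma germ_sadd a b F G : germ a F -> germ b G -> germ (sadd a b) (fun z => F z + G z).
Proof.
intros [Ga Ha] [Gb Hb]. split; [apply geometric_sadd; assumption|].
refine (near_mp _ _ _ Ha _). refine (near_mp _ _ _ Hb _).
generalize (near_psum_sadd a b Ga Gb). apply filter_imp. intros z -> -> ->. reflexivity.
Qed.

Lemma germ_sscal c a F : germ a F -> germ (sscal c a) (fun z => c * F z).
Proof.
intros [Ga Ha]. split; [apply geometric_sscal; assumption|].
refine (near_mp _ _ _ Ha _).
generalize (near_psum_sscal c a Ga). apply filter_imp. intros z -> ->. reflexivity.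
Qed.

Lemma germ_sshift a F : germ a F -> germ (sshift a) (fun z => z * F z).
Proof.
intros [Ga Ha]. split; [apply geometric_sshift; assumption|].
refine (near_mp _ _ _ Ha _).
generalize (near_psum_sshift a Ga). apply filter_imp. intros z -> ->. reflexivity.
Qed.

Lemma germ_conv a b F G : germ a F -> germ b G -> germ (conv a b) (fun z => F z * G z).
Proof.
intros [Ga Ha] [Gb Hb]. split; [apply geometric_conv; assumption|].
refine (near_mp _ _ _ Ha _). refine (near_mp _ _ _ Hb _).
generalize (near_psum_conv a b Ga Gb). apply filter_imp. intros z -> -> ->. reflexivity.
Qed.

Lemma germ_sconst c : germ (sconst c) (fun _ => c).
Proof.
assert (G : geometric (sconst c)).
{ apply geometric_intro with (Cmod c) 1%R; [|lra]. assert (H := Cmod_ge_0 c).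
  intros [|n]; simpl; [lra|]. rewrite Cmod_0, pow1. lra. }
split; [exact G|].
refine (near_mp _ _ _ (near_psum_stail _ G) _).
generalize (near_psum_sscal 0 _ G). apply filter_imp. intros z E ->.
rewrite (psum_ext _ (sscal 0 (sconst c))), E.
- simpl. ring.
- intros n. unfold stail, sscal. simpl. ring.
Qed.

Lemma germ_near a F G : near 0 (fun z => F z = G z) -> germ a F -> germ a G.
Proof.
intros H [Ga Ha]. split; [exact Ga|]. refine (near_mp _ _ _ Ha _).
revert H. apply filter_imp. intros z -> ->. reflexivity.
Qed.

Lemma identity_theorem_eq (V : C -> Prop) (a b : nat -> C) :
  ~ V 0 -> (forall P, near 0 P -> exists z, V z /\ P z) ->
  geometric a -> geometric b -> near 0 (fun z => V z -> psum a z = psum b z) ->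
  forall n, a n = b n.
Proof.
intros V0 HV Ga Gb H n.
assert (Gm := germ_sadd _ _ _ _ (germ_psum a Ga) (germ_sscal (-(1)) _ _ (germ_psum b Gb))).
apply Ceq_minus. replace (a n - b n) with (sadd a (sscal (-(1)) b) n)
  by (unfold sadd, sscal; ring).
apply (identity_theorem V); [exact V0|exact HV|apply Gm|].
refine (near_mp _ _ _ (proj2 Gm) _). revert H. apply filter_imp.
intros z E1 E2 Vz. rewrite E2, (E1 Vz). ring.
Qed.

(** * The linear system at a simple zero *)

(** The index [nu] now stands for [D = (A - C) / z]. *)
Definition reduced (a : unknown -> nat -> C) (x : unknown) (n : nat) : C :=
  match x with nu => a mu_plus (S n) - a nu (S n) | _ => a x n end.

(** The regular system for [A], [B], [D], indexed by [mu_plus], [mu_minus], [nu]; [matrix_value]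
    gives the same entries at a point [z]. *)
Definition system_matrix (t : C) (g K : nat -> C) (i j : unknown) : nat -> C :=
  match i, j with
  | mu_plus, mu_plus => sscal (2 / 3) (sshift K)
  | mu_plus, mu_minus => sconst 0
  | mu_plus, nu => sconst (1 / 3)
  | mu_minus, mu_plus => sconst (1 / 3)
  | mu_minus, mu_minus => sscal (- (2 / 3)) (sshift K)
  | mu_minus, nu => sscal (- (1 / 3)) (sshift (sconst 1))
  | nu, mu_plus =>
      sscal (2 / 3) (sadd (sscal 3 K) (sadd (conv (sshift K) (sshift K))
        (sscal (- (1)) (sadd (sadd (sconst t) (sshift (sconst 1)))
          (conv (sshift g) (sshift g))))))
  | nu, mu_minus => sscal (- (2 / 3)) (sshift (conv g g))
  | nu, nu => sconst 0
  end.

Definition matrix_value (t z G K : C) (i j : unknown) : C :=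
  match i, j with
  | mu_plus, mu_plus => 2 / 3 * (z * K)
  | mu_plus, nu | mu_minus, mu_plus => 1 / 3
  | mu_minus, mu_minus => - (2 / 3) * (z * K)
  | mu_minus, nu => - (1 / 3) * z
  | nu, mu_plus => 2 / 3 * (3 * K + z ^ 2 * K ^ 2 - (t + z) - z ^ 2 * G ^ 2)
  | nu, mu_minus => - (2 / 3) * (z * G ^ 2)
  | _, _ => 0
  end.

(** [reduced] forgets the coefficient [a nu 0], so [A(0) = C(0)] has to be recorded separately. *)
Definition type3_coefficients (t : C) (g K : nat -> C) (a : unknown -> nat -> C) : Prop :=
  a nu 0%nat = a mu_plus 0%nat /\ regular_solution (system_matrix t g K) (reduced a).

(** The linear system at [t + z] with [q (t + z) = z G], after the powers of the
    branch have been divided out of the unknowns. *)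
Definition reduced_equations (t z G G' : C) (f f' : unknown -> C) : Prop :=
  G * (f mu_plus - f nu) = 3 * z * G * f' mu_plus - 2 * z * G' * f mu_plus /\
  3 * G * f' mu_minus = - (2) * G' * f mu_minus + G * f nu /\
  3 * z * G ^ 2 * f' nu - 2 * G ^ 2 * f nu =
    2 * z ^ 3 * G ^ 4 * f mu_minus
    - 2 * ((G + z * G') ^ 2 - (t + z) * (z * G) ^ 2 - (z * G) ^ 4) * f mu_plus.

(** For equations of which one is a nonzero multiple of the other: the multiplier is named by hand
    and [field] does the rest. *)
Lemma Ceq_scale (c x y u v : C) : c <> 0 -> x - y = c * (u - v) -> (x = y <-> u = v).
Proof.
intros Hc E. split; intros H.
- apply Ceq_minus. destruct (Ceq_dec (u - v) 0) as [H0|H0]; [exact H0|exfalso].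
  apply (Cmult_neq_0 c (u - v) Hc H0). rewrite <- E, H. ring.
- apply Ceq_minus. rewrite E, H. ring.
Qed.

Lemma three_neq_0 : RtoC 3 <> 0.
Proof. intros E. apply RtoC_inj in E. lra. Qed.

Lemma reduced_equations_regular (t z G K : C) (y y' f f' : unknown -> C) :
  z <> 0 -> G <> 0 ->
  f mu_plus = y mu_plus -> f mu_minus = y mu_minus -> f nu = y mu_plus - z * y nu ->
  f' mu_plus = y' mu_plus -> f' mu_minus = y' mu_minus ->
  f' nu = y' mu_plus - y nu - z * y' nu ->
  reduced_equations t z G (z * (K * G)) f f' <->
  (forall i, y' i = matrix_value t z G K i mu_plus * y mu_plus
     + (matrix_value t z G K i mu_minus * y mu_minus + matrix_value t z G K i nu * y nu)).
Proof.
intros Hz HG F1 F2 F3 D1 D2 D3.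
unfold reduced_equations. rewrite F1, F2, F3, D1, D2, D3.
assert (H3 := three_neq_0).
assert (N1 : - (3) * (z * G) <> 0).
{ repeat apply Cmult_neq_0; auto. intros E. apply H3. replace (RtoC 3) with (- - (3)) by ring.
  rewrite E. ring. }
assert (N2 : 3 * G <> 0) by (apply Cmult_neq_0; assumption).
assert (N3 : - (3) * (z * z * (G * G)) <> 0).
{ repeat apply Cmult_neq_0; auto. intros E. apply H3. replace (RtoC 3) with (- - (3)) by ring.
  rewrite E. ring. }
assert (S1 : G * (y mu_plus - (y mu_plus - z * y nu)) =
   3 * z * G * y' mu_plus - 2 * z * (z * (K * G)) * y mu_plus <->
   y' mu_plus = 2 / 3 * (z * K) * y mu_plus + (0 * y mu_minus + 1 / 3 * y nu)).
{ apply (Ceq_scale (- (3) * (z * G))); [exact N1|]. field; exact H3. }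
assert (S2 : 3 * G * y' mu_minus = - (2) * (z * (K * G)) * y mu_minus + G * (y mu_plus - z * y nu) <->
   y' mu_minus = 1 / 3 * y mu_plus + (- (2 / 3) * (z * K) * y mu_minus + - (1 / 3) * z * y nu)).
{ apply (Ceq_scale (3 * G)); [exact N2|]. field; exact H3. }
(* Only after [A'] is replaced through the first equation do the terms in [D] cancel,
   [1 - 3 + 2 = 0]. Everything left is divisible by [z^2 G^2], thanks to [G' = z K G]. *)
assert (S3 : y' mu_plus = 2 / 3 * (z * K) * y mu_plus + (0 * y mu_minus + 1 / 3 * y nu) ->
  (3 * z * G ^ 2 * (y' mu_plus - y nu - z * y' nu) - 2 * G ^ 2 * (y mu_plus - z * y nu) =
   2 * z ^ 3 * G ^ 4 * y mu_minus
   - 2 * ((G + z * (z * (K * G))) ^ 2 - (t + z) * (z * G) ^ 2 - (z * G) ^ 4) * y mu_plus <->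
   y' nu = 2 / 3 * (3 * K + z ^ 2 * K ^ 2 - (t + z) - z ^ 2 * G ^ 2) * y mu_plus
     + (- (2 / 3) * (z * G ^ 2) * y mu_minus + 0 * y nu))).
{ intros E1. apply (Ceq_scale (- (3) * (z * z * (G * G)))); [exact N3|].
  rewrite E1. field; exact H3. }
split.
- intros [E1 [E2 E3]]. apply S1 in E1. apply S2 in E2. apply (S3 E1) in E3.
  intros [| |]; assumption.
- intros R. assert (E1 := R mu_plus). assert (E2 := R mu_minus). assert (E3 := R nu).
  split; [apply S1, E1|]. split; [apply S2, E2|]. apply (S3 E1), E3.
Qed.

Ltac germs := repeat match goal with
  | |- germ (sconst _) _ => apply germ_sconst
  | |- germ (sscal _ _) _ => apply germ_sscal
  | |- germ (sadd _ _) _ => apply germ_sadd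
  | |- germ (conv _ _) _ => apply germ_conv
  | |- germ (sshift _) _ => apply germ_sshift
  | |- germ _ _ => apply germ_psum; assumption
  end.

Lemma germ_system_matrix (t : C) (g K : nat -> C) i j :
  geometric g -> geometric K ->
  germ (system_matrix t g K i j) (fun z => matrix_value t z (psum g z) (psum K z) i j).
Proof.
intros Gg GK.
destruct i, j; unfold system_matrix; (eapply germ_near; [|germs]);
  apply filter_forall; intros z; unfold matrix_value; simpl; ring.
Qed.

Lemma germ_system_rhs (M : unknown -> unknown -> nat -> C) (m : C -> unknown -> unknown -> C)
  (y : unknown -> nat -> C) i :
  (forall j, germ (M i j) (fun z => m z i j)) -> (forall x, geometric (y x)) ->
  germ (system_rhs M y i) (fun z => m z i mu_plus * psum (y mu_plus) z
     + (m z i mu_minus * psum (y mu_minus) z + m z i nu * psum (y nu) z)).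
Proof.
intros HM Gy. unfold system_rhs.
apply germ_sadd; [|apply germ_sadd]; (apply germ_conv; [apply HM|apply germ_psum, Gy]).
Qed.

Lemma geometric_reduced a : (forall x, geometric (a x)) -> forall x, geometric (reduced a x).
Proof.
intros Ga [| |]; [apply Ga|apply Ga|].
apply geometric_ext with (sadd (stail (a mu_plus)) (sscal (- (1)) (stail (a nu)))).
- intros n. unfold sadd, sscal, stail, reduced. ring.
- apply geometric_sadd; [|apply geometric_sscal]; apply geometric_stail, Ga.
Qed.

Lemma near_reduced a :
  (forall x, geometric (a x)) -> a nu 0%nat = a mu_plus 0%nat ->
  near 0 (fun z =>
    psum (a nu) z = psum (a mu_plus) z - z * psum (reduced a nu) z /\
    psum (sder (a nu)) z = psum (sder (a mu_plus)) z - psum (reduced a nu) z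
       - z * psum (sder (reduced a nu)) z).
Proof.
intros Ga E0.
assert (Gp := Ga mu_plus). assert (GD := geometric_reduced a Ga nu).
assert (Gp' := geometric_sder _ Gp). assert (GD' := geometric_sder _ GD).
assert (H1 := germ_sadd _ _ _ _ (germ_psum _ Gp)
  (germ_sscal (- (1)) _ _ (germ_sshift _ _ (germ_psum _ GD)))).
assert (H2 := germ_sadd _ _ _ _ (germ_psum _ Gp') (germ_sscal (- (1)) _ _
  (germ_sadd _ _ _ _ (germ_psum _ GD) (germ_sshift _ _ (germ_psum _ GD'))))).
refine (near_mp _ _ _ (proj2 H1) _). generalize (proj2 H2). apply filter_imp.
intros z E2 E1. split.
- transitivity (psum (sadd (a mu_plus) (sscal (- (1)) (sshift (reduced a nu)))) z).
  + apply psum_ext. intros [|n]; unfold sadd, sscal, sshift, reduced; [rewrite E0|]; ring.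
  + rewrite E1. ring.
- transitivity (psum (sadd (sder (a mu_plus))
       (sscal (- (1)) (sadd (reduced a nu) (sshift (sder (reduced a nu)))))) z).
  + apply psum_ext. intros [|n]; unfold sadd, sscal, sshift, sder, reduced.
    * simpl. ring.
    * rewrite (S_INR (S n)), RtoC_plus. ring.
  + rewrite E2. ring.
Qed.

(** The identity theorem serves twice. The first equation yields [A(0) = C(0)], so that [D] is a
    power series; then the equations, equivalent on [V] to the regular system because [z] and [g] do
    not vanish there near 0, are compared coefficient by coefficient. *)
Lemma coefficients_iff (V : C -> Prop) (t : C) (g K : nat -> C) (a : unknown -> nat -> C) :
  ~ V 0 -> (forall P, near 0 P -> exists z, V z /\ P z) ->
  geometric g -> geometric K -> g 0%nat <> 0 ->
  (forall n, sder g n = sshift (conv K g) n) -> (forall x, geometric (a x)) ->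
  near 0 (fun z => V z -> reduced_equations t z (psum g z) (psum (sder g) z)
     (fun x => psum (a x) z) (fun x => psum (sder (a x)) z)) <->
  type3_coefficients t g K a.
Proof.
intros V0 HV Gg GK g0 HK Ga.
assert (Gg' := geometric_sder _ Gg).
assert (HG : near 0 (fun z => psum g z <> 0)).
{ refine (derivative_nonzero_near _ _ _ (locally_singleton _ _ (near_psum_derivative g Gg)) _).
  rewrite psum_0. exact g0. }
assert (HG' : near 0 (fun z => psum (sder g) z = z * (psum K z * psum g z))).
{ assert (H := proj2 (germ_sshift _ _ (germ_conv _ _ _ _ (germ_psum _ GK) (germ_psum _ Gg)))).
  revert H. apply filter_imp. intros z E. rewrite <- E. apply psum_ext, HK. }
assert (Gr := geometric_reduced a Ga).
assert (Grhs : forall i, germ (system_rhs (system_matrix t g K) (reduced a) i) (fun z =>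
   matrix_value t z (psum g z) (psum K z) i mu_plus * psum (reduced a mu_plus) z
     + (matrix_value t z (psum g z) (psum K z) i mu_minus * psum (reduced a mu_minus) z
     + matrix_value t z (psum g z) (psum K z) i nu * psum (reduced a nu) z))).
{ intros i. apply (germ_system_rhs _ (fun z => matrix_value t z (psum g z) (psum K z)));
    [intros j; apply germ_system_matrix; assumption|exact Gr]. }
assert (Hiff : a nu 0%nat = a mu_plus 0%nat -> near 0 (fun z => V z ->
   (reduced_equations t z (psum g z) (psum (sder g) z)
     (fun x => psum (a x) z) (fun x => psum (sder (a x)) z) <->
   forall i, psum (sder (reduced a i)) z =
     psum (system_rhs (system_matrix t g K) (reduced a) i) z))).
{ intros E0.
  refine (near_mp _ _ _ HG _). refine (near_mp _ _ _ HG' _).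
  refine (near_mp _ _ _ (near_reduced a Ga E0) _).
  refine (near_mp _ _ _ (proj2 (Grhs mu_plus)) _).
  refine (near_mp _ _ _ (proj2 (Grhs mu_minus)) _).
  refine (near_mp _ _ _ (proj2 (Grhs nu)) _).
  apply filter_forall. intros z R3 R2 R1 [N1 N2] EG' NG Vz.
  rewrite EG'.
  rewrite (reduced_equations_regular t z (psum g z) (psum K z)
    (fun x => psum (reduced a x) z) (fun x => psum (sder (reduced a x)) z)); auto.
  - split; intros H [| |].
    + rewrite R1. apply H.
    + rewrite R2. apply H.
    + rewrite R3. apply H.
    + rewrite <- R1. apply H.
    + rewrite <- R2. apply H.
    + rewrite <- R3. apply H.
  - intros E. subst z. exact (V0 Vz). }
split.
- intros H.
  assert (E0 : a nu 0%nat = a mu_plus 0%nat).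
  { assert (Gp := Ga mu_plus). assert (Gp' := geometric_sder _ Gp). assert (Gn := Ga nu).
    (* The first equation as the series [g (A - C) + z (2 g' A - 3 g A')], whose constant term is
       [g(0) (A(0) - C(0))]. *)
    assert (Gs := germ_sadd _ _ _ _
      (germ_conv _ _ _ _ (germ_psum _ Gg) (germ_sadd _ _ _ _ (germ_psum _ Gp)
         (germ_sscal (- (1)) _ _ (germ_psum _ Gn))))
      (germ_sshift _ _ (germ_sadd _ _ _ _
        (germ_sscal (- (3)) _ _ (germ_conv _ _ _ _ (germ_psum _ Gg) (germ_psum _ Gp')))
        (germ_sscal 2 _ _ (germ_conv _ _ _ _ (germ_psum _ Gg') (germ_psum _ Gp)))))).
    match type of Gs with germ ?s _ =>
      assert (Z : near 0 (fun z => V z -> psum s z = 0)) end.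
    { refine (near_mp _ _ _ (proj2 Gs) _). revert H. apply filter_imp.
      intros z H E Vz. rewrite E. destruct (H Vz) as [E1 _].
      apply Ceq_minus in E1. rewrite <- E1. ring. }
    assert (Z0 := identity_theorem V _ V0 HV (proj1 Gs) Z 0%nat).
    unfold sadd at 1, conv at 1, sshift, sadd, sscal in Z0.
    rewrite sum_O in Z0. simpl in Z0.
    symmetry. apply Ceq_minus.
    destruct (Ceq_dec (a mu_plus 0%nat - a nu 0%nat) 0) as [E|E]; [exact E|exfalso].
    apply (Cmult_neq_0 _ _ g0 E). rewrite <- Z0. ring. }
  split; [exact E0|]. intros i.
  apply (identity_theorem_eq V); auto.
  + apply geometric_sder, Gr.
  + apply Grhs.
  + refine (near_mp _ _ _ H _). generalize (Hiff E0). apply filter_imp.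
    intros z Hz H1 Vz. apply Hz; auto.
- intros [E0 H]. generalize (Hiff E0). apply filter_imp.
  intros z Hz Vz. apply Hz; auto. intros i. apply psum_ext, H.
Qed.

(** * Powers of the cube-root branch and their derivatives *)

Lemma branch_nonzero V r z : cbrt_branch V r -> V z -> z <> 0 /\ r z <> 0.
Proof.
intros [_ [V0 [_ H]]] Vz. assert (Hz : z <> 0) by (intros E; subst z; auto).
split; [exact Hz|]. intros E. apply Hz. rewrite <- (proj2 (H z Vz)), E. ring.
Qed.

Lemma branch_open V r z : cbrt_branch V r -> V z -> near z V.
Proof. intros [[H _] _] Vz. apply H, Vz. Qed.

Lemma Cmod_sub_lower (a b : C) : (Cmod a - Cmod b <= Cmod (a + b))%R.
Proof.
assert (H := Cmod_triangle (a + b) (- b)). rewrite Cmod_opp in H.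
replace (a + b + - b) with a in H by ring. lra.
Qed.

(** Derivative of an inverse function: [y - z] is a difference of cubes of branch values, so
    everything is expressed through the increment [h] of the branch, which continuity makes
    small. *)
Lemma branch_derivative V r z :
  cbrt_branch V r -> V z -> has_derivative r z (r z / (3 * z)).
Proof.
intros Hr Vz. destruct (branch_nonzero V r z Hr Vz) as [Hz Hw].
assert (HO := branch_open V r z Hr Vz).
destruct Hr as [_ [_ [_ Hr]]]. destruct (Hr z Vz) as [Hc E3].
assert (Hm := proj1 (Cmod_gt_0 _) Hw). set (b := r z) in *. set (m := Cmod b) in *.
apply derivative_Cmod. intros eps Heps.
(* The bound [m / 4] keeps [3 b^2 + 3 b h + h^2] above [2 m^2] in modulus; the other one then
   controls the remainder [h^2 (3 b + h) / (3 b^2)]. *)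
set (d := Rmin (m / 4) (eps * (m * m * m))).
assert (Hd : (0 < d)%R).
{ apply Rmin_glb_lt; [lra|]. repeat apply Rmult_lt_0_compat; assumption. }
assert (Hnear : near z (fun y => (Cmod (r y - b) < d)%R)).
{ apply (Hc (fun w => (Cmod (w - b) < d)%R)). apply near_ball, Hd. }
refine (near_mp _ _ _ HO _). revert Hnear. apply filter_imp. intros y Hy Vy.
destruct (Hr y Vy) as [_ Ey]. set (a := r y) in *.
fold b. rewrite <- E3, <- Ey. set (h := a - b) in *.
assert (Ea : a = b + h) by (unfold h; ring).
rewrite Ea in *. clearbody h. clear Ea.
assert (Hh1 : (Cmod h < m / 4)%R) by (eapply Rlt_le_trans; [exact Hy|apply Rmin_l]).
assert (Hh2 : (Cmod h < eps * (m * m * m))%R) by (eapply Rlt_le_trans; [exact Hy|apply Rmin_r]).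
assert (G := Cmod_ge_0 h).
replace (h - ((b + h) ^ 3 - b ^ 3) * (b / (3 * b ^ 3)))
  with (- (h * h * (3 * b + h) / (3 * (b * b)))) by (field; auto using three_neq_0).
replace ((b + h) ^ 3 - b ^ 3) with (h * (3 * (b * b) + h * (3 * b + h))) by ring.
rewrite Cmod_opp, Cmod_div by (repeat apply Cmult_neq_0; auto using three_neq_0).
rewrite !Cmod_mult, Cmod_R, (Rabs_right 3) by lra. fold m.
assert (H1 : (Cmod (3 * b + h) <= 4 * m)%R).
{ eapply Rle_trans; [apply Cmod_triangle|]. rewrite Cmod_mult, Cmod_R, Rabs_right by lra.
  fold m. lra. }
assert (H2 : (2 * (m * m) <= Cmod (3 * (b * b) + h * (3 * b + h)))%R).
{ eapply Rle_trans; [|apply Cmod_sub_lower].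
  rewrite !Cmod_mult, Cmod_R, (Rabs_right 3) by lra. fold m.
  assert (Cmod h * Cmod (3 * b + h) <= m / 4 * (4 * m))%R
    by (apply Rmult_le_compat; auto using Cmod_ge_0; lra). lra. }
apply Rle_trans with (Cmod h * (eps * (2 * (m * m))))%R.
2:{ replace (eps * (Cmod h * Cmod (3 * (b * b) + h * (3 * b + h))))%R
      with (Cmod h * (eps * Cmod (3 * (b * b) + h * (3 * b + h))))%R by ring.
    apply Rmult_le_compat_l; [exact G|]. apply Rmult_le_compat_l; lra. }
assert (Hmm : (0 < 3 * (m * m))%R) by nra.
apply Rmult_le_reg_r with (3 * (m * m))%R; [exact Hmm|].
unfold Rdiv. rewrite Rmult_assoc, Rinv_l, Rmult_1_r by lra.
replace (Cmod h * (eps * (2 * (m * m))) * (3 * (m * m)))%R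
  with (Cmod h * ((6 * m) * (eps * (m * m * m))))%R by ring.
rewrite Rmult_assoc. apply Rmult_le_compat_l; [exact G|].
rewrite (Rmult_comm (6 * m)).
apply Rmult_le_compat; auto using Cmod_ge_0; lra.
Qed.

Lemma derivative_inv_id (z : C) : z <> 0 -> has_derivative (fun y => / y) z (- / (z * z)).
Proof.
intros Hz. assert (Hm := proj1 (Cmod_gt_0 _) Hz). set (m := Cmod z) in *.
apply derivative_Cmod. intros eps Heps.
set (d := Rmin (m / 2) (eps * (m * m * m) / 2)).
assert (Hp : (0 < m * m * m)%R) by (repeat apply Rmult_lt_0_compat; assumption).
assert (Hd : (0 < d)%R) by (apply Rmin_glb_lt; [lra|]; nra).
generalize (near_ball z d Hd). apply filter_imp. intros y Hy.
assert (Hh1 : (Cmod (y - z) < m / 2)%R) by (eapply Rlt_le_trans; [exact Hy|apply Rmin_l]).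
assert (Hh2 : (Cmod (y - z) < eps * (m * m * m) / 2)%R)
  by (eapply Rlt_le_trans; [exact Hy|apply Rmin_r]).
assert (Hy1 : (m / 2 <= Cmod y)%R).
{ assert (H := Cmod_sub_lower z (y - z)). assert (E : z + (y - z) = y :> C) by ring. rewrite E in H.
  fold m in H. lra. }
assert (Hy0 : y <> RtoC 0) by (apply Cmod_gt_0; lra).
assert (G := Cmod_ge_0 (y - z)).
replace (/ y - / z - (y - z) * - / (z * z)) with ((y - z) * (y - z) / (y * (z * z)))
  by (field; split; assumption).
rewrite Cmod_div by (repeat apply Cmult_neq_0; assumption).
rewrite !Cmod_mult. fold m.
assert (Hden : (0 < Cmod y * (m * m))%R) by (apply Rmult_lt_0_compat; nra).
apply Rmult_le_reg_r with (Cmod y * (m * m))%R; [exact Hden|].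
unfold Rdiv. rewrite Rmult_assoc, Rinv_l, Rmult_1_r by lra.
rewrite (Rmult_comm eps), !Rmult_assoc. apply Rmult_le_compat_l; [exact G|].
apply Rle_trans with (eps * (m / 2 * (m * m)))%R; [lra|].
apply Rmult_le_compat_l; [lra|]. apply Rmult_le_compat_r; nra.
Qed.

Notation generic_exponents := (thirds 1 (-2) (-2)).

(** With [w = z^(1/3)], the power [z^(-2/3)] is written [w / z], so that its derivative follows from
    the product rule. *)
Definition branch_weight (x : unknown) (w z : C) : C :=
  match x with mu_plus => w | _ => w * / z end.

Lemma third_pow_generic V r z x :
  cbrt_branch V r -> V z ->
  third_pow r (generic_exponents x) z = branch_weight x (r z) z.
Proof.
intros Hr Vz. destruct (branch_nonzero V r z Hr Vz) as [Hz Hw].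
destruct Hr as [_ [_ [_ H]]]. destruct (H z Vz) as [_ E].
assert (Ei : / z = / (r z ^ 3)) by (rewrite E; reflexivity).
destruct x; simpl; [ring| |]; rewrite Ei; field; exact Hw.
Qed.

Lemma third_pow_derivative V r z x :
  cbrt_branch V r -> V z ->
  has_derivative (third_pow r (generic_exponents x)) z
    (match x with mu_plus => 1 / 3 | _ => - (2 / 3) end / z * branch_weight x (r z) z).
Proof.
intros Hr Vz. destruct (branch_nonzero V r z Hr Vz) as [Hz Hw].
apply derivative_ext with (fun y => branch_weight x (r y) y).
{ generalize (branch_open V r z Hr Vz). apply filter_imp. intros y Vy.
  symmetry. apply (third_pow_generic V); assumption. }
assert (D := branch_derivative V r z Hr Vz).
destruct x; simpl branch_weight.
- eapply derivative_eq; [exact D|]. field; auto using three_neq_0.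
- eapply derivative_eq; [apply (derivative_mult _ _ _ _ _ D (derivative_inv_id z Hz))|].
  field; auto using three_neq_0.
- eapply derivative_eq; [apply (derivative_mult _ _ _ _ _ D (derivative_inv_id z Hz))|].
  field; auto using three_neq_0.
Qed.

Lemma linear_system_at (q : C -> C) (f : unknown -> C -> C) (s q' : C) (f' : unknown -> C) :
  has_derivative q s q' -> (forall x, has_derivative (f x) s (f' x)) ->
  linear_system q f s <->
  3 * q s ^ 2 * f' mu_plus = 2 * q s * q' * f mu_plus s - q s ^ 2 * f nu s /\
  3 * q s ^ 2 * f' mu_minus = - (2 * q s * q') * f mu_minus s + q s ^ 2 * f nu s /\
  3 * q s ^ 2 * f' nu = 2 * q s ^ 4 * f mu_minus s
     - 2 * (q' ^ 2 - s * q s ^ 2 - q s ^ 4) * f mu_plus s.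
Proof.
intros Dq Df.
assert (E : C_derive (fun y => q y ^ 2) s = 2 * q s * q').
{ apply is_C_derive_unique. eapply derivative_eq.
  - apply derivative_ext with (fun y => q y * q y).
    + apply filter_forall. intros y. simpl. ring.
    + apply (derivative_mult _ _ _ _ _ Dq Dq).
  - ring. }
unfold linear_system, u_of. rewrite E, (is_C_derive_unique _ _ _ Dq).
rewrite !(is_C_derive_unique _ _ _ (Df _)).
split; [intros [_ H]; exact H|]. intros H. split; [|exact H].
intros x. exists (f' x). apply Df.
Qed.

(** The derivatives of the branch powers contribute [1/3] or [-2/3] over [z]. Dividing the three
    equations by [- w z G], [w z G] and [w] then removes the branch. *)
Lemma linear_system_series V r (q : C -> C) (t z G G' : C) (f : unknown -> C -> C)
  (b : unknown -> nat -> C) :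
  cbrt_branch V r -> V z -> G <> 0 ->
  q (t + z) = z * G -> has_derivative q (t + z) (G + z * G') ->
  near z (fun y => forall x, f x (t + y) = third_pow r (generic_exponents x) y * psum (b x) y) ->
  (forall x, has_derivative (psum (b x)) z (psum (sder (b x)) z)) ->
  linear_system q f (t + z) <->
  reduced_equations t z G G' (fun x => psum (b x) z) (fun x => psum (sder (b x)) z).
Proof.
intros Hr Vz HG Eq Dq Hf Db. destruct (branch_nonzero V r z Hr Vz) as [Hz Hw].
assert (H3 := three_neq_0).
set (w := r z) in *.
assert (Df : forall x, has_derivative (f x) (t + z)
  (match x with mu_plus => 1 / 3 | _ => - (2 / 3) end / z * branch_weight x w z * psum (b x) z
    + branch_weight x w z * psum (sder (b x)) z)).
{ intros x. apply derivative_shift.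
  apply derivative_ext with (fun y => third_pow r (generic_exponents x) y * psum (b x) y).
  - revert Hf. apply filter_imp. intros y Hy. symmetry. apply Hy.
  - eapply derivative_eq.
    + apply (derivative_mult _ _ _ _ _ (third_pow_derivative V r z x Hr Vz) (Db x)).
    + rewrite (third_pow_generic V) by assumption. reflexivity. }
rewrite (linear_system_at q f _ _ _ Dq Df).
assert (Ef := locally_singleton _ _ Hf). cbv beta in Ef.
rewrite !Ef, !(third_pow_generic V) by assumption. fold w. rewrite Eq.
unfold reduced_equations. simpl branch_weight.
set (A := psum (b mu_plus) z). set (B := psum (b mu_minus) z). set (D := psum (b nu) z).
set (A' := psum (sder (b mu_plus)) z). set (B' := psum (sder (b mu_minus)) z).
set (D' := psum (sder (b nu)) z).
assert (S1 : 3 * (z * G) ^ 2 * (1 / 3 / z * w * A + w * A') =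
   2 * (z * G) * (G + z * G') * (w * A) - (z * G) ^ 2 * (w * / z * D) <->
   G * (A - D) = 3 * z * G * A' - 2 * z * G' * A).
{ apply (Ceq_scale (- (w * z * G))).
  - intros E. apply (Cmult_neq_0 (w * z) G); [apply Cmult_neq_0; assumption|exact HG|].
    replace (w * z * G) with (- - (w * z * G)) by ring. rewrite E. ring.
  - field; auto. }
assert (S2 : 3 * (z * G) ^ 2 * (- (2 / 3) / z * (w * / z) * B + w * / z * B') =
   - (2 * (z * G) * (G + z * G')) * (w * / z * B) + (z * G) ^ 2 * (w * / z * D) <->
   3 * G * B' = - (2) * G' * B + G * D).
{ apply (Ceq_scale (w * z * G)).
  - repeat apply Cmult_neq_0; assumption.
  - field; auto. }
assert (S3 : 3 * (z * G) ^ 2 * (- (2 / 3) / z * (w * / z) * D + w * / z * D') =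
   2 * (z * G) ^ 4 * (w * / z * B)
     - 2 * ((G + z * G') ^ 2 - (t + z) * (z * G) ^ 2 - (z * G) ^ 4) * (w * A) <->
   3 * z * G ^ 2 * D' - 2 * G ^ 2 * D = 2 * z ^ 3 * G ^ 4 * B
     - 2 * ((G + z * G') ^ 2 - (t + z) * (z * G) ^ 2 - (z * G) ^ 4) * A).
{ apply (Ceq_scale w); [exact Hw|]. field; auto. }
rewrite S1, S2, S3. reflexivity.
Qed.

(** * The three types of series solutions *)

(** Coefficients of [z^(s x)] times the series of [a x]: a solution with higher exponents, read as
    one with the generic exponents. *)
Definition shifted (s : unknown -> nat) (a : unknown -> nat -> C) (x : unknown) : nat -> C :=
  Nat.iter (s x) sshift (a x).

Lemma iter_sshift_add s (a : nat -> C) n : Nat.iter s sshift a (n + s)%nat = a n.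
Proof.
induction s as [|s IH]; [simpl; f_equal; lia|]. rewrite Nat.add_succ_r. exact IH.
Qed.

Lemma iter_sshift_lt s (a : nat -> C) n : (n < s)%nat -> Nat.iter s sshift a n = 0.
Proof.
revert n. induction s as [|s IH]; intros n H; [lia|].
destruct n as [|n]; [reflexivity|]. apply IH. lia.
Qed.

Lemma germ_iter_sshift s a F : germ a F -> germ (Nat.iter s sshift a) (fun z => z ^ s * F z).
Proof.
intros H. induction s as [|s IH].
- eapply germ_near; [|exact H]. apply filter_forall. intros z. simpl. ring.
- eapply germ_near; [|apply germ_sshift, IH]. apply filter_forall. intros z. simpl. ring.
Qed.

(** Everything the linear system sees of a simple zero of a Painlevé II
    transcendent: [q (t + z) = z g(z)] and [g' = z K g]. *)
Definition simple_zero_data (q : C -> C) (t : C) (g K : nat -> C) : Prop :=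
  geometric g /\ geometric K /\ g 0%nat <> 0 /\
  (forall n, sder g n = sshift (conv K g) n) /\
  near 0 (fun z => q (t + z) = z * psum g z /\
    has_derivative q (t + z) (psum g z + z * psum (sder g) z)).

Lemma painleve_simple_zero_data (U : C -> Prop) (q : C -> C) (t : C) :
  domain U -> painleve2_solution U q -> (exists s, U s /\ q s <> 0) -> U t -> q t = 0 ->
  exists g K, simple_zero_data q t g K.
Proof.
intros HU Hq Hs Ut q0.
destruct (painleve_zero_expansion U q t HU Hq Hs Ut q0) as [Q [GQ [Q0 [Q1 [Q2 HQ]]]]].
set (g := stail Q). assert (Gg : geometric g) by apply geometric_stail, GQ.
assert (Gg' := geometric_sder g Gg).
(* [K] is [g' / (z g)]: dividing [g'] by [z] is exact because [Q 2] vanishes, and [g(0) = Q 1] is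
   nonzero. *)
destruct (power_series_division g (stail (sder g)) Gg (geometric_stail _ Gg') Q1)
  as [K [GK HK]].
exists g, K. split; [exact Gg|]. split; [exact GK|]. split; [exact Q1|]. split.
- intros [|n]; [|simpl; rewrite HK; reflexivity].
  unfold sder, g, stail. rewrite Q2. simpl. ring.
- refine (near_mp _ _ _ HQ _). refine (near_mp _ _ _ (near_psum_stail Q GQ) _).
  assert (GD := germ_sadd _ _ _ _ (germ_psum _ Gg) (germ_sshift _ _ (germ_psum _ Gg'))).
  generalize (proj2 GD). apply filter_imp. intros z E2 E1 [E D]. split.
  + rewrite E, E1, Q0. unfold g. ring.
  + rewrite <- E2. eapply derivative_eq; [exact D|]. apply psum_ext.
    intros [|n]; unfold sder, sadd, sshift, g, stail.
    * simpl. ring.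
    * rewrite (S_INR (S n)), RtoC_plus. ring.
Qed.

Lemma third_pow_nonzero (r : C -> C) k z : r z <> 0 -> third_pow r k z <> 0.
Proof.
intros H. destruct k; simpl.
- apply C1_nz.
- apply Cpow_nz, H.
- intros E. apply (Cpow_nz _ (Pos.to_nat p)) in H. apply C1_nz.
  rewrite <- (Cinv_r _ H), E. ring.
Qed.

(** Separates a condition on the coefficients alone from the representation of [f] by them.
    Convergence at a single point of [V], necessarily nonzero, already makes the coefficients
    geometric. *)
Lemma series_solution_iff V r q t g K k s f a :
  cbrt_branch V r -> simple_zero_data q t g K ->
  (forall x z, V z -> third_pow r (k x) z = z ^ s x * third_pow r (generic_exponents x) z) ->
  series_solution V r q t k f a <->
  (forall x, geometric (a x)) /\ type3_coefficients t g K (shifted s a) /\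
  near 0 (fun z => V z -> forall x, f x (t + z) = third_pow r (k x) z * psum (a x) z).
Proof.
intros Hr [Gg [GK [g0 [HK Hq]]]] Hk.
assert (Hr' := Hr). destruct Hr' as [_ [V0 [HV _]]].
assert (Gsh : (forall x, geometric (a x)) -> forall x, germ (shifted s a x)
   (fun z => z ^ s x * psum (a x) z)) by (intros Ga x; apply germ_iter_sshift, germ_psum, Ga).
assert (Hiff : (forall x, geometric (a x)) ->
  near 0 (fun z => V z -> forall x, f x (t + z) = third_pow r (k x) z * psum (a x) z) ->
  near 0 (fun z => V z -> (linear_system q f (t + z) <->
    reduced_equations t z (psum g z) (psum (sder g) z)
     (fun x => psum (shifted s a x) z) (fun x => psum (sder (shifted s a x)) z)))).
{ intros Ga Hf. specialize (Gsh Ga).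
  assert (HG : near 0 (fun z => psum g z <> 0)).
  { refine (derivative_nonzero_near _ _ _ (locally_singleton _ _ (near_psum_derivative g Gg)) _).
    rewrite psum_0. exact g0. }
  assert (HN : near 0 (fun z => forall x, psum (shifted s a x) z = z ^ s x * psum (a x) z)).
  { refine (near_mp _ _ _ (proj2 (Gsh mu_plus)) _).
    refine (near_mp _ _ _ (proj2 (Gsh mu_minus)) _).
    generalize (proj2 (Gsh nu)). apply filter_imp. intros z E1 E2 E3 [| |]; assumption. }
  assert (HD : near 0 (fun z => forall x, has_derivative (psum (shifted s a x)) z
       (psum (sder (shifted s a x)) z))).
  { refine (near_mp _ _ _ (near_psum_derivative _ (proj1 (Gsh mu_plus))) _).
    refine (near_mp _ _ _ (near_psum_derivative _ (proj1 (Gsh mu_minus))) _).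
    generalize (near_psum_derivative _ (proj1 (Gsh nu))). apply filter_imp.
    intros z E1 E2 E3 [| |]; assumption. }
  refine (near_mp _ _ _ HG _). refine (near_mp _ _ _ HD _). refine (near_mp _ _ _ Hq _).
  (* Derivatives at [z] see a neighbourhood of [z], so the representation of [f] and the shift
     identity are needed all around [z]. *)
  refine (near_mp _ _ _ (near_near _ _ HN) _).
  generalize (near_near _ _ Hf). apply filter_imp.
  intros z Nf NN [Eq Dq] Db NG Vz.
  apply (linear_system_series V r); auto.
  refine (near_mp _ _ _ (branch_open V r z Hr Vz) _).
  refine (near_mp _ _ _ Nf _). revert NN. apply filter_imp.
  intros y E1 E2 Vy x. rewrite (E2 Vy x), (E1 x), (Hk x y Vy). ring. }
split.
- intros H. unfold series_solution, within in H.
  assert (Hf : near 0 (fun z => V z -> forall x, f x (t + z) = third_pow r (k x) z * psum (a x) z)).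
  { revert H. apply filter_imp. intros z H Vz x. destruct (H Vz) as [_ Hx].
    destruct (Hx x) as [l [Hl E]]. apply is_pseries_has_sum in Hl.
    rewrite E, (psum_unique _ _ _ Hl). reflexivity. }
  assert (Ga : forall x, geometric (a x)).
  { intros x. destruct (HV _ H) as [z [Vz Hz]]. destruct (Hz Vz) as [_ Hx].
    destruct (Hx x) as [l [Hl _]]. apply is_pseries_has_sum in Hl.
    apply (geometric_of_has_sum _ z l); [|exact Hl]. intros E. subst z. auto. }
  split; [exact Ga|]. split; [|exact Hf].
  apply (coefficients_iff V); auto; [intros x; apply Gsh, Ga|].
  refine (near_mp _ _ _ H _). generalize (Hiff Ga Hf). apply filter_imp.
  intros z Hz HL Vz. apply Hz; [exact Vz|]. apply HL, Vz.
- intros [Ga [HC Hf]].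
  apply (coefficients_iff V) in HC; auto; [|intros x; apply Gsh, Ga].
  unfold series_solution, within.
  refine (near_mp _ _ _ HC _). refine (near_mp _ _ _ Hf _).
  refine (near_mp _ _ _ (near_psum _ (Ga mu_plus)) _).
  refine (near_mp _ _ _ (near_psum _ (Ga mu_minus)) _).
  refine (near_mp _ _ _ (near_psum _ (Ga nu)) _).
  generalize (Hiff Ga Hf). apply filter_imp. intros z Hz S3 S2 S1 E HE Vz. split.
  + apply Hz; auto.
  + intros x. exists (psum (a x) z). split; [|apply E, Vz].
    apply is_pseries_has_sum. destruct x; assumption.
Qed.

(** * Linear combinations and dual bases of coefficient families *)

Lemma lin_comb_0 c v : lin_comb 0 c v = 0.
Proof. unfold lin_comb. rewrite sum_n_m_zero by lia. reflexivity. Qed.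

Lemma lin_comb_S N c v : lin_comb (S N) c v = lin_comb N c v + c (S N) * v (S N).
Proof. unfold lin_comb. rewrite sum_n_Sm by lia. reflexivity. Qed.

Lemma lin_comb_ext N c v c' v' :
  (forall i, (1 <= i <= N)%nat -> c i * v i = c' i * v' i) ->
  lin_comb N c v = lin_comb N c' v'.
Proof. intros H. apply sum_n_m_ext_loc. exact H. Qed.

Lemma lin_comb_scal N c v (w : C) : lin_comb N c (fun i => w * v i) = w * lin_comb N c v.
Proof.
induction N as [|N IH]; [rewrite !lin_comb_0; ring|]. rewrite !lin_comb_S, IH. ring.
Qed.

Lemma lin_comb_delta N c j :
  (1 <= j <= N)%nat -> lin_comb N c (fun i => if Nat.eqb i j then 1 else 0) = c j.
Proof.
intros Hj.
assert (H0 : forall M, (M < j)%nat -> lin_comb M c (fun i => if Nat.eqb i j then 1 else 0) = 0).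
{ induction M as [|M IH]; intros HM; [apply lin_comb_0|].
  rewrite lin_comb_S, IH by lia. rewrite (proj2 (Nat.eqb_neq (S M) j)) by lia. ring. }
induction N as [|N IH]; [lia|]. rewrite lin_comb_S.
destruct (Nat.eq_dec j (S N)) as [->|E].
- rewrite H0, Nat.eqb_refl by lia. ring.
- rewrite IH by lia. rewrite (proj2 (Nat.eqb_neq (S N) j)) by lia. ring.
Qed.

Lemma germ_lin_comb N c (A : nat -> nat -> C) :
  (forall i, geometric (A i)) ->
  germ (fun n => lin_comb N c (fun i => A i n)) (fun z => lin_comb N c (fun i => psum (A i) z)).
Proof.
intros HA. induction N as [|N IH].
- destruct (germ_sconst 0) as [G H]. split.
  + revert G. apply geometric_ext. intros [|n]; rewrite lin_comb_0; reflexivity.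
  + revert H. apply filter_imp. intros z H. rewrite lin_comb_0, <- H. apply psum_ext.
    intros [|n]; rewrite lin_comb_0; reflexivity.
- assert (G := germ_sadd _ _ _ _ IH (germ_sscal (c (S N)) _ _ (germ_psum _ (HA (S N))))).
  destruct G as [G H]. split.
  + revert G. apply geometric_ext. intros n. rewrite lin_comb_S. reflexivity.
  + revert H. apply filter_imp. intros z H. rewrite lin_comb_S, <- H. apply psum_ext.
    intros n. rewrite lin_comb_S. reflexivity.
Qed.

(** [A 1], ..., [A N] is the basis of coefficient families dual to the free
    constants at the positions [p 1], ..., [p N]. *)
Lemma series_type_intro V r q t k N (A : nat -> unknown -> nat -> C) (p : nat -> unknown * nat) :
  cbrt_branch V r ->
  (forall i x, geometric (A i x)) ->
  (forall f a, series_solution V r q t k f a <->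
     (exists c, forall x n, a x n = lin_comb N c (fun i => A i x n)) /\
     near 0 (fun z => V z -> forall x, f x (t + z) = third_pow r (k x) z * psum (a x) z)) ->
  (forall i j, (1 <= i <= N)%nat -> (1 <= j <= N)%nat ->
     A i (fst (p j)) (snd (p j)) = if Nat.eqb i j then 1 else 0) ->
  (forall i x n, (1 <= i <= N)%nat -> (n < snd (p i))%nat -> A i x n = 0) ->
  (forall x, exists i, (1 <= i <= N)%nat /\ A i x 0%nat <> 0) ->
  series_type V r q t k N.
Proof.
intros Hr GA HS HP HT HL.
assert (Hr' := Hr). destruct Hr' as [_ [V0 [HV _]]].
assert (Hfree : forall c a, (forall x n, a x n = lin_comb N c (fun i => A i x n)) ->
  forall j, (1 <= j <= N)%nat -> a (fst (p j)) (snd (p j)) = c j).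
{ intros c a Ha j Hj. rewrite Ha, <- (lin_comb_delta N c j Hj) at 1.
  apply lin_comb_ext. intros i Hi. rewrite HP by assumption. reflexivity. }
assert (Hsol : forall c, near 0 (fun z => forall x,
  psum (fun n => lin_comb N c (fun i => A i x n)) z = lin_comb N c (fun i => psum (A i x) z))).
{ intros c. assert (G := fun x => proj2 (germ_lin_comb N c (fun i => A i x) (fun i => GA i x))).
  refine (near_mp _ _ _ (G mu_plus) _). refine (near_mp _ _ _ (G mu_minus) _).
  generalize (G nu). apply filter_imp. intros z E1 E2 E3 [| |]; assumption. }
set (b := fun i x y => third_pow r (k x) (y - t) * psum (A i x) (y - t)).
assert (Hb : forall c z x, lin_comb N c (fun i => b i x (t + z)) =
   third_pow r (k x) z * lin_comb N c (fun i => psum (A i x) z)).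
{ intros c z x. rewrite <- lin_comb_scal. apply lin_comb_ext. intros i _. unfold b.
  replace (t + z - t) with z by ring. reflexivity. }
split.
- exists b. split.
  + intros f. split.
    * intros [a Ha]. apply HS in Ha. destruct Ha as [[c Hc] Hf]. exists c.
      refine (near_mp _ _ _ Hf _). generalize (Hsol c). apply filter_imp.
      intros z E Ef Vz x. rewrite Hb, <- E, (Ef Vz x). f_equal. apply psum_ext, Hc.
    * intros [c Hc]. exists (fun x n => lin_comb N c (fun i => A i x n)). apply HS. split.
      { exists c. reflexivity. }
      refine (near_mp _ _ _ Hc _). generalize (Hsol c). apply filter_imp.
      intros z E Ef Vz x. rewrite (Ef Vz x), Hb, <- E. reflexivity.
  + intros c Hc j Hj.
    assert (Hz : forall x n, lin_comb N c (fun i => A i x n) = 0).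
    { intros x. apply (identity_theorem V _ V0 HV).
      - exact (proj1 (germ_lin_comb N c (fun i => A i x) (fun i => GA i x))).
      - refine (near_mp _ _ _ Hc _). generalize (Hsol c). apply filter_imp.
        intros z E E0 Vz. specialize (E0 Vz x). cbv beta in E0. rewrite Hb, <- E in E0.
        destruct (branch_nonzero V r z Hr Vz) as [_ Hw].
        destruct (Ceq_dec (psum (fun n => lin_comb N c (fun i => A i x n)) z) 0) as [F|F];
          [exact F|exfalso].
        exact (Cmult_neq_0 _ _ (third_pow_nonzero r (k x) z Hw) F E0). }
    rewrite <- (Hfree c (fun x n => lin_comb N c (fun i => A i x n))) by auto.
    apply Hz.
- exists p. split; [|split].
  + intros c. set (a := fun x n => lin_comb N c (fun i => A i x n)).
    exists (fun x y => third_pow r (k x) (y - t) * psum (a x) (y - t)), a. split.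
    * apply HS. split; [exists c; reflexivity|]. apply filter_forall. intros z _ x.
      assert (E : t + z - t = z :> C) by ring. rewrite E. reflexivity.
    * intros i Hi. apply (Hfree c a); auto.
  + intros f a f' a' n Ha Ha' Hlow Hn x.
    apply HS in Ha. apply HS in Ha'. destruct Ha as [[c Hc] _], Ha' as [[c' Hc'] _].
    rewrite Hc, Hc'. apply lin_comb_ext. intros i Hi.
    (* Constants placed beyond index [n] do not reach it, those at index [n] agree by [Hn], and the
       earlier ones by [Hlow]. *)
    destruct (Nat.lt_total n (snd (p i))) as [Hlt|Hge].
    { rewrite HT by assumption. ring. }
    rewrite <- (Hfree c a Hc i Hi), <- (Hfree c' a' Hc' i Hi). f_equal.
    destruct Hge as [E|Hlt]; [|apply Hlow, Hlt].
    rewrite <- E. apply Hn; auto.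
  (* Each leading coefficient is a linear form in the free constants; the three forms define the
     excluded hyperplanes. *)
  + exists (cons (fun i => A i mu_plus 0%nat) (cons (fun i => A i mu_minus 0%nat)
      (cons (fun i => A i nu 0%nat) nil))). split.
    * intros h [<-|[<-|[<-|[]]]]; apply HL.
    * intros c Hh f a Ha Hc x. apply HS in Ha. destruct Ha as [[c' Hc'] _].
      assert (E : a x 0%nat = lin_comb N (fun i => A i x 0%nat) c).
      { rewrite Hc'. apply lin_comb_ext. intros i Hi.
        rewrite <- (Hc i Hi), (Hfree c' a Hc' i Hi). ring. }
      rewrite E. apply Hh. destruct x; simpl; auto.
Qed.

(** * The three-parameter space of coefficients *)

Lemma regular_solution_ext M y y' :
  (forall x n, y x n = y' x n) -> regular_solution M y -> regular_solution M y'.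
Proof.
intros E H i n. rewrite <- (system_rhs_ext M y y' i n) by auto.
rewrite <- H. unfold sder. rewrite E. reflexivity.
Qed.

(** Index 0 of the equation for [A] says [D(0) = 3 A'(0)], whence the factor [-2]. These are the
    coefficients that become leading ones in types 1 and 2. *)
Lemma type3_leading t g K a :
  type3_coefficients t g K a ->
  a nu 0%nat = a mu_plus 0%nat /\ a mu_minus 1%nat = / 3 * a mu_plus 0%nat /\
  a nu 1%nat = - (2) * a mu_plus 1%nat /\
  a mu_minus 2%nat = - / 3 * (a mu_plus 1%nat + K 0%nat * a mu_minus 0%nat).
Proof.
intros [E0 H]. split; [exact E0|].
assert (H3 := three_neq_0).
assert (Hp := H mu_plus 0%nat). assert (Hm := H mu_minus 0%nat).
assert (Hm1 := H mu_minus 1%nat).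
unfold sder, system_rhs, sadd, conv, system_matrix, reduced in Hp, Hm, Hm1.
rewrite !sum_O in Hp, Hm. rewrite !sum_Sn, !sum_O in Hm1.
change plus with Cplus in Hm1.
unfold sscal, sshift, sconst in Hp, Hm, Hm1.
change (INR 1) with 1%R in Hp, Hm. change (INR 2) with (1 + 1)%R in Hm1.
rewrite RtoC_plus in Hm1. simpl Nat.sub in Hp, Hm, Hm1.
set (a0 := a mu_plus 0%nat) in *. set (a1 := a mu_plus 1%nat) in *.
set (b0 := a mu_minus 0%nat) in *. set (b1 := a mu_minus 1%nat) in *.
set (b2 := a mu_minus 2%nat) in *. set (c1 := a nu 1%nat) in *.
assert (Ec : c1 = - (2) * a1).
{ replace c1 with (a1 - 3 * (1 / 3 * (a1 - c1))) by (field; exact H3).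
  replace (1 / 3 * (a1 - c1)) with (1 * a1) by (rewrite Hp; field; exact H3). ring. }
split; [|split; [exact Ec|]].
- replace b1 with (1 * b1) by ring. rewrite Hm. field; exact H3.
- replace b2 with (/ 2 * ((1 + 1) * b2)) by field.
  rewrite Hm1, Ec. field; exact H3.
Qed.

(** Since [D(0) = 3 A'(0)], the three given values amount to initial values of the regular
    system. *)
Lemma type3_unique t g K a a' :
  type3_coefficients t g K a -> type3_coefficients t g K a' ->
  a mu_plus 0%nat = a' mu_plus 0%nat -> a mu_minus 0%nat = a' mu_minus 0%nat ->
  a mu_plus 1%nat = a' mu_plus 1%nat -> forall x n, a x n = a' x n.
Proof.
intros H H' E0 E1 E2.
destruct (type3_leading _ _ _ _ H) as [L0 [_ [L1 _]]].
destruct (type3_leading _ _ _ _ H') as [L0' [_ [L1' _]]].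
assert (E := regular_solution_unique _ _ _ (proj2 H) (proj2 H')).
assert (Er : forall n x, reduced a x n = reduced a' x n).
{ apply E. intros [| |]; simpl; [exact E0|exact E1|]. rewrite L1, L1', E2. reflexivity. }
intros [| |] n; [apply (Er n mu_plus)|apply (Er n mu_minus)|].
destruct n as [|n]; [rewrite L0, L0'; exact E0|].
assert (F := Er n nu). assert (F' := Er (S n) mu_plus). simpl in F, F'.
replace (a nu (S n)) with (a mu_plus (S n) - (a mu_plus (S n) - a nu (S n))) by ring.
rewrite F, F'. ring.
Qed.

Lemma type3_exists t g K (al be ga : C) :
  geometric g -> geometric K ->
  exists a, (forall x, geometric (a x)) /\ type3_coefficients t g K a /\
    a mu_plus 0%nat = al /\ a mu_minus 0%nat = be /\ a mu_plus 1%nat = ga.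
Proof.
intros Gg GK.
destruct (regular_solution_exists (system_matrix t g K)
  (* The value [ga] wanted for [A'(0)] is imposed through [D(0) = 3 A'(0)]. *)
  (fun x => match x with mu_plus => al | mu_minus => be | nu => 3 * ga end))
  as [y [Gy [y0 Hy]]].
{ intros i j. exact (proj1 (germ_system_matrix t g K i j Gg GK)). }
(* Undoes the reduction by [C = A - z D]. *)
set (a := fun x => match x with
  | nu => sadd (y mu_plus) (sscal (- (1)) (sshift (y nu))) | _ => y x end).
assert (HC : type3_coefficients t g K a).
{ split; [unfold a, sadd, sscal; simpl; ring|].
  revert Hy. apply regular_solution_ext. intros [| |] n; [reflexivity|reflexivity|].
  unfold reduced, a, sadd, sscal, sshift. ring. }
exists a. split; [|split; [exact HC|split; [apply y0|split; [apply y0|]]]].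
- intros [| |]; [apply Gy|apply Gy|].
  apply geometric_sadd, geometric_sscal, geometric_sshift; apply Gy.
- destruct (type3_leading _ _ _ _ HC) as [_ [_ [L _]]].
  assert (E : a mu_plus 1%nat - a nu 1%nat = 3 * ga).
  { unfold a, sadd, sscal, sshift. rewrite y0. ring. }
  rewrite L in E. replace (a mu_plus 1%nat) with
    (/ 3 * (a mu_plus 1%nat - - (2) * a mu_plus 1%nat)) by (field; exact three_neq_0).
  rewrite E. field; exact three_neq_0.
Qed.

Lemma type3_lin_comb t g K N c (B : nat -> unknown -> nat -> C) :
  (forall i, type3_coefficients t g K (B i)) ->
  type3_coefficients t g K (fun x n => lin_comb N c (fun i => B i x n)).
Proof.
intros HB. induction N as [|N [IH0 IH]].
- split; [rewrite !lin_comb_0; reflexivity|].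
  (* The empty combination is obtained as [B 0 - B 0]. *)
  assert (H := regular_solution_combination _ _ _ (- (1)) (proj2 (HB 0%nat)) (proj2 (HB 0%nat))).
  revert H. apply regular_solution_ext. intros [| |] n; unfold reduced, sadd, sscal;
    rewrite !lin_comb_0; ring.
- split.
  + rewrite !lin_comb_S, IH0, (proj1 (HB (S N))). reflexivity.
  + assert (H := regular_solution_combination _ _ _ (c (S N)) IH (proj2 (HB (S N)))).
    revert H. apply regular_solution_ext. intros [| |] n; unfold reduced, sadd, sscal;
      rewrite !lin_comb_S; ring.
Qed.

(** Types 1 and 2 are the type-3 solutions whose coefficients start late: the
    coefficients [a] of exponents [k] are type-3 coefficients shifted by [s]. *)
Lemma series_type_of_basis V r q t g K k s N (B : nat -> unknown -> nat -> C)
  (p : nat -> unknown * nat) :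
  cbrt_branch V r -> simple_zero_data q t g K ->
  (forall x z, V z -> third_pow r (k x) z = z ^ s x * third_pow r (generic_exponents x) z) ->
  (forall i, type3_coefficients t g K (B i)) ->
  (forall i x, geometric (B i x)) ->
  (forall i x n, (n < s x)%nat -> B i x n = 0) ->
  (forall a, type3_coefficients t g K (shifted s a) ->
     exists c, forall x n, shifted s a x n = lin_comb N c (fun i => B i x n)) ->
  (forall i j, (1 <= i <= N)%nat -> (1 <= j <= N)%nat ->
     B i (fst (p j)) (snd (p j) + s (fst (p j)))%nat = if Nat.eqb i j then 1 else 0) ->
  (forall i x n, (1 <= i <= N)%nat -> (n < snd (p i))%nat -> B i x (n + s x)%nat = 0) ->
  (forall x, exists i, (1 <= i <= N)%nat /\ B i x (s x) <> 0) ->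
  series_type V r q t k N.
Proof.
intros Hr Hd Hk HC GB HB Hspan HP HT HL.
assert (GA : forall i x, geometric (fun n => B i x (n + s x)%nat)).
{ intros i x. generalize (s x). intros m. induction m as [|m IH].
  - apply geometric_ext with (2 := GB i x). intros n. f_equal. lia.
  - apply geometric_ext with (2 := geometric_stail _ IH). intros n. unfold stail. f_equal. lia. }
apply (series_type_intro V r q t k N (fun i x n => B i x (n + s x)%nat) p); auto.
intros f a. rewrite (series_solution_iff V r q t g K k s f a Hr Hd Hk).
split.
- intros [_ [H Hf]]. split; [|exact Hf].
  destruct (Hspan a H) as [c Hc]. exists c. intros x n. rewrite <- Hc. unfold shifted.
  symmetry. apply iter_sshift_add.
- intros [[c Hc] Hf]. split; [|split; [|exact Hf]].
  + intros x. apply geometric_ext with (fun n => lin_comb N c (fun i => B i x (n + s x)%nat)).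
    * intros n. symmetry. apply Hc.
    * exact (proj1 (germ_lin_comb N c (fun i n => B i x (n + s x)%nat) (fun i => GA i x))).
  + assert (E : forall x n, lin_comb N c (fun i => B i x n) = shifted s a x n).
    { intros x n. unfold shifted. destruct (Nat.lt_ge_cases n (s x)) as [Hn|Hn].
      - rewrite iter_sshift_lt by exact Hn.
        rewrite (lin_comb_ext N c _ c (fun _ => 0 * 1)).
        + rewrite lin_comb_scal. ring.
        + intros i _. rewrite HB by exact Hn. ring.
      - replace n with ((n - s x) + s x)%nat by lia. rewrite iter_sshift_add, Hc. reflexivity. }
    destruct (type3_lin_comb t g K N c B HC) as [T0 T].
    split; [rewrite <- !E; exact T0|].
    revert T. apply regular_solution_ext. intros [| |] n; unfold reduced; rewrite <- ?E; reflexivity.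
Qed.

Lemma third_pow_shift_types V r x z :
  cbrt_branch V r -> V z ->
  third_pow r (thirds 4 4 1 x) z =
    z ^ match x with mu_minus => 2 | _ => 1 end * third_pow r (generic_exponents x) z /\
  third_pow r (thirds 1 1 (-2) x) z =
    z ^ match x with mu_minus => 1 | _ => 0 end * third_pow r (generic_exponents x) z.
Proof.
intros Hr Vz. rewrite (third_pow_generic V) by assumption.
destruct (branch_nonzero V r z Hr Vz) as [Hz Hw].
destruct Hr as [_ [_ [_ H]]]. destruct (H z Vz) as [_ E].
assert (E4 : r z ^ 4 = z * r z) by (rewrite <- E at 2; ring).
assert (E2 : / (r z ^ 2) = r z * / z).
{ assert (Ei : / z = / (r z ^ 3)) by (rewrite E; reflexivity). rewrite Ei. field. exact Hw. }
destruct x; split; simpl in *.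
- rewrite E4. ring.
- ring.
- rewrite E4. field. exact Hz.
- field. exact Hz.
- field. exact Hz.
- rewrite E2. ring.
Qed.

Lemma lin_comb_1 c v : lin_comb 1 c v = c 1%nat * v 1%nat.
Proof. rewrite lin_comb_S, lin_comb_0. ring. Qed.

Lemma lin_comb_2 c v : lin_comb 2 c v = c 1%nat * v 1%nat + c 2%nat * v 2%nat.
Proof. rewrite lin_comb_S, lin_comb_1. ring. Qed.

Lemma lin_comb_3 c v :
  lin_comb 3 c v = c 1%nat * v 1%nat + c 2%nat * v 2%nat + c 3%nat * v 3%nat.
Proof. rewrite lin_comb_S, lin_comb_2. ring. Qed.

Theorem theorem3
  (U : C -> Prop) (q : C -> C) (t0 : C) (V : C -> Prop) (r : C -> C)
  (hU : domain U) (hq : painleve2_solution U q)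
  (hq0 : exists t, U t /\ q t <> 0)
  (ht0 : U t0) (hqt0 : q t0 = 0)
  (hr : cbrt_branch V r) :
  series_type V r q t0 (thirds 4 4 1) 1 /\
  series_type V r q t0 (thirds 1 1 (-2)) 2 /\
  series_type V r q t0 (thirds 1 (-2) (-2)) 3.
Proof.
destruct (painleve_simple_zero_data U q t0 hU hq hq0 ht0 hqt0) as [g [K hd]].
assert (Gg := proj1 hd). assert (GK := proj1 (proj2 hd)).
(* [B1], [B2], [B3] form the basis dual to the constants [A(0)], [B(0)], [A'(0)]. *)
destruct (type3_exists t0 g K 1 0 0 Gg GK) as [B1 [G1 [C1 [P1 [M1 Q1]]]]].
destruct (type3_exists t0 g K 0 1 0 Gg GK) as [B2 [G2 [C2 [P2 [M2 Q2]]]]].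
destruct (type3_exists t0 g K 0 0 1 Gg GK) as [B3 [G3 [C3 [P3 [M3 Q3]]]]].
destruct (type3_leading _ _ _ _ C1) as [L1 [L1' [L1'' _]]].
destruct (type3_leading _ _ _ _ C2) as [L2 _].
destruct (type3_leading _ _ _ _ C3) as [L3 [L3' [L3'' Lb2]]].
rewrite P1 in L1, L1'. rewrite P2 in L2. rewrite P3 in L3, L3'. rewrite Q3 in L3'', Lb2.
rewrite M3 in Lb2.
assert (H3 := three_neq_0).
assert (H3i : / 3 <> 0).
{ intros E. apply C1_nz. rewrite <- (Cinv_r 3 H3), E. ring. }
assert (Hspan : forall a, type3_coefficients t0 g K a -> forall x n,
   a x n = a mu_plus 0%nat * B1 x n + a mu_minus 0%nat * B2 x n + a mu_plus 1%nat * B3 x n).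
{ intros a Ha.
  set (c := fun i => match i with 1%nat => a mu_plus 0%nat | 2%nat => a mu_minus 0%nat
    | _ => a mu_plus 1%nat end).
  set (B := fun i => match i with 1%nat => B1 | 2%nat => B2 | _ => B3 end).
  assert (HB : forall i, type3_coefficients t0 g K (B i))
    by (intros [|[|[|i]]]; assumption).
  intros x n.
  rewrite (type3_unique _ _ _ _ _ Ha (type3_lin_comb t0 g K 3 c B HB)).
  - rewrite lin_comb_3. reflexivity.
  - rewrite lin_comb_3. simpl. rewrite P1, P2, P3. ring.
  - rewrite lin_comb_3. simpl. rewrite M1, M2, M3. ring.
  - rewrite lin_comb_3. simpl. rewrite Q1, Q2, Q3. ring. }
split; [|split].
(* The shifts [1, 2, 1] are the differences from the exponents [1/3, -2/3, -2/3]; they force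
   [A(0) = B(0) = 0] and leave [B3]. Its [mu_minus] part can begin at index 2 because the
   coefficient of index 1 is [A(0) / 3]. *)
- apply (series_type_of_basis V r q t0 g K _
    (fun x => match x with mu_minus => 2%nat | _ => 1%nat end) 1 (fun _ => B3)
    (fun _ => (mu_plus, 0%nat))); auto.
  + intros x z Vz. apply (third_pow_shift_types V); assumption.
  + intros _ [| |] n Hn; (destruct n as [|[|n]]; [| |lia]); try lia; try assumption.
    rewrite L3'. ring.
  + intros a Ha. exists (fun _ => a mu_plus 0%nat). intros x n.
    rewrite (Hspan _ Ha x n), lin_comb_1. unfold shifted. simpl. ring.
  + intros i j Hi Hj. replace i with 1%nat by lia. replace j with 1%nat by lia. exact Q3.
  + simpl. intros. lia.
  (* The leading coefficients of [B3] after the shift are 1, [-1/3] and [-2]. *)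
  + intros x. exists 1%nat. split; [lia|]. destruct x.
    * rewrite Q3. apply C1_nz.
    * rewrite Lb2. intros E. apply H3i. replace (/ 3) with (- (- / 3 * (1 + K 0%nat * 0))) by ring.
      rewrite E. ring.
    * rewrite L3''. intros E. apply C1_nz. replace (RtoC 1) with (- / 2 * (- (2) * 1)) by field.
      rewrite E. ring.
(* Only [mu_minus] is shifted, which imposes [B(0) = 0]. The free constants are [K_0] and [K_1];
   already [B1] has all its leading coefficients nonzero, namely 1, [1/3] and 1. *)
- apply (series_type_of_basis V r q t0 g K _
    (fun x => match x with mu_minus => 1%nat | _ => 0%nat end) 2
    (fun i => match i with 1%nat => B1 | _ => B3 end)
    (fun i => (mu_plus, pred i))); auto.
  + intros x z Vz. apply (third_pow_shift_types V); assumption.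
  + intros [|[|i]]; assumption.
  + intros [|[|i]]; assumption.
  + intros i x n Hn. destruct x; try lia. replace n with 0%nat by lia.
    destruct i as [|[|i]]; assumption.
  + intros a Ha. exists (fun i => match i with 1%nat => a mu_plus 0%nat
      | _ => a mu_plus 1%nat end). intros x n.
    rewrite (Hspan _ Ha x n), lin_comb_2. unfold shifted. simpl. ring.
  + intros i j Hi Hj. destruct i as [|[|[|i]]]; try lia; destruct j as [|[|[|j]]]; try lia;
      simpl; assumption.
  + intros i x n Hi Hn. destruct i as [|[|[|i]]]; simpl in Hn; try lia.
    replace n with 0%nat by lia. destruct x; simpl; [assumption| |assumption].
    rewrite L3'. ring.
  + intros x. exists 1%nat. split; [lia|]. destruct x.
    * rewrite P1. apply C1_nz.
    * rewrite L1'. intros E. apply H3i. rewrite <- E. ring.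
    * rewrite L1. apply C1_nz.
(* The free constants are [K_0], [M_0] and [K_1]; [S_0] equals [K_0]. *)
- apply (series_type_of_basis V r q t0 g K _ (fun _ => 0%nat) 3
    (fun i => match i with 1%nat => B1 | 2%nat => B2 | _ => B3 end)
    (fun i => match i with 1%nat => (mu_plus, 0%nat) | 2%nat => (mu_minus, 0%nat)
       | _ => (mu_plus, 1%nat) end)); auto.
  + intros x z Vz. simpl. ring.
  + intros [|[|[|i]]]; assumption.
  + intros [|[|[|i]]]; assumption.
  + intros. lia.
  + intros a Ha. exists (fun i => match i with 1%nat => a mu_plus 0%nat
      | 2%nat => a mu_minus 0%nat | _ => a mu_plus 1%nat end). intros x n.
    rewrite lin_comb_3. exact (Hspan _ Ha x n).
  + intros i j Hi Hj. destruct i as [|[|[|[|i]]]]; try lia;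
      destruct j as [|[|[|[|j]]]]; try lia; simpl; assumption.
  + intros i x n Hi Hn. destruct i as [|[|[|[|i]]]]; simpl in Hn; try lia.
    replace n with 0%nat by lia. destruct x; simpl; assumption.
  + intros [| |].
    * exists 1%nat. split; [lia|]. rewrite P1. apply C1_nz.
    * exists 2%nat. split; [lia|]. rewrite M2. apply C1_nz.
    * exists 1%nat. split; [lia|]. rewrite L1. apply C1_nz.
Qed.
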